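(* Let $0<\alpha<2\pi$ and let $A=(A_{11},A_{12},\mathrm{Id}_\ell)$ be a monic elliptic tuple with standard root $V=(S+i\,\mathrm{Id}_\ell)D$. For $\lambda\in\mathbb{C}\setminus\{0\}$, the model problem for $A$ with angle $\alpha$ and mixed boundary conditions has a solution $r^\lambda v\neq0$ if and only if $$0\in\sigma(M_{\lambda,\alpha})\quad\text{for}\quad M_{\lambda,\alpha}=\tfrac12\,[D^{-1/2}SD^{-1/2},D]\,\bigl(Z_\alpha^{\lambda_+}-\overline{Z_\alpha}^{\,\lambda_-}\bigr)+i\bigl(Z_\alpha^{\lambda_+}+\overline{Z_\alpha}^{\,\lambda_-}\bigr),$$ where $Z_\alpha=\cos(\alpha)\,\mathrm{Id}_\ell+\sin(\alpha)\,D^{1/2}SD^{1/2}+i\sin(\alpha)\,D$ and $[X,Y]=XY-YX$.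
   Context: **Monic elliptic tuples.** $A=(A_{11},A_{12},\mathrm{Id}_\ell)$ with $A_{11},A_{12}\in\operatorname{Mat}_\ell(\mathbb{R})$ symmetric is a monic elliptic tuple if $A_{11}$ is positive definite and $L_A(\xi)=A_{11}\xi_1^2+2A_{12}\xi_1\xi_2+\mathrm{Id}_\ell\,\xi_2^2$ satisfies $\det L_A(\xi)\neq0$ for all $\xi\in\mathbb{R}^2\setminus\{0\}$. Put $A_{22}=\mathrm{Id}_\ell$, $A_{21}=A_{12}$, $L_A(\partial_{x_1},\partial_{x_2})=\sum_{i,j=1}^2A_{ij}\partial_{x_i}\partial_{x_j}$. Its standard root is the unique $V\in\operatorname{Mat}_\ell(\mathbb{C})$ with $\sigma(V)\subset\{\operatorname{Im}z>0\}$ and $L_A(1,\beta)=(V^*-\beta\,\mathrm{Id}_\ell)(V-\beta\,\mathrm{Id}_\ell)$ for all $\beta\in\mathbb{C}$; it can be written $V=(S+i\,\mathrm{Id}_\ell)D$ with $S,D\in\operatorname{Mat}_\ell(\mathbb{R})$ symmetric, $D$ positive definite ($D=\operatorname{Im}V$, $S=(\operatorname{Re}V)D^{-1}$). **Complex powers.** For $z\in\mathbb{C}\setminus\{0\}$ and $\lambda\in\mathbb{C}$, $z^{\lambda_\pm}:=\exp(\lambda\log_\pm z)$ with $\log_\pm z:=\log|z|+i\arg_\pm z$, $\arg_+z\in[0,2\pi)$, $\arg_-z\in(-2\pi,0]$. Powers of matrices are defined by the holomorphic functional calculus. For $0<\alpha<2\pi$ the spectra of $Z_\alpha$ and of its entrywise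 complex conjugate $\overline{Z_\alpha}$ do not meet $[0,\infty)$. **Model problem.** Use polar coordinates on the angle $\mathcal{K}_\alpha=\{r>0,0\le\varphi\le\alpha\}$ with sides $\Gamma^-=\{\varphi=0\}$, $\Gamma^+=\{\varphi=\alpha\}$. The conormal derivative on the side at angle $\varphi\in\{0,\alpha\}$ is $\sum_{i,j=1}^2A_{ij}n_i\partial_{x_j}$ with $n=(-\sin\varphi,\cos\varphi)$. A solution $r^\lambda v$ of the model problem with mixed boundary conditions is a function $u(r,\varphi)=r^\lambda v(\varphi)$, $v:[0,\alpha]\to\mathbb{C}^\ell$ smooth, with $L_A(\partial_{x_1},\partial_{x_2})u=0$ on $\mathcal{K}_\alpha$, vanishing conormal derivative on $\Gamma^-$ (Neumann) and $u=0$ on $\Gamma^+$ (Dirichlet). *)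

(* Defs.v *)
From HB Require Import structures.
From mathcomp Require Import all_boot all_order all_algebra.
From mathcomp Require Import all_classical all_reals all_analysis.
From mathcomp Require Import complex ring lra.

Set Implicit Arguments.
Unset Strict Implicit.
Unset Printing Implicit Defensive.

Import Order.TTheory GRing.Theory Num.Theory.
Import numFieldNormedType.Exports.
Import Normc.

Local Open Scope classical_set_scope.
Local Open Scope ring_scope.
Local Open Scope complex_scope.

Local Notation Re := complex.Re.
Local Notation Im := complex.Im.

Section Tuples.
Variable R : realType.
Variable l : nat.

Definition posdefmx (D : 'M[R]_l) : Prop :=
  D^T = D /\ forall x : 'cV[R]_l, x != 0 -> 0 < (x^T *m D *m x) 0 0.

Definition symbol2 (K : comPzRingType) (A11 A12 : 'M[K]_l) (x y : K) :
    'M[K]_l :=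
  x ^+ 2 *: A11 + (2 * x * y) *: A12 + (y ^+ 2)%:M.

Definition monic_elliptic (A11 A12 : 'M[R]_l) : Prop :=
  [/\ posdefmx A11, A12^T = A12 &
      forall x y : R, (x, y) <> (0, 0) -> \det (symbol2 A11 A12 x y) != 0].

(* The coefficients A_ij with A_22 = Id and A_21 = A_12; the indices 1, 2 are
   represented by 0, 1 : 'I_2. *)
Definition tuple_coef (A11 A12 : 'M[R]_l) (i j : 'I_2) : 'M[R]_l :=
  if (i == 0) && (j == 0) then A11
  else if (i == 1) && (j == 1) then 1%:M else A12.

Definition toC (m n : nat) (X : 'M[R]_(m, n)) : 'M[R[i]]_(m, n) :=
  map_mx (real_complex R) X.

Definition conjmx (m n : nat) (X : 'M[R[i]]_(m, n)) : 'M[R[i]]_(m, n) :=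
  map_mx (@conjc R) X.

Definition standard_root (A11 A12 : 'M[R]_l) (V : 'M[R[i]]_l) : Prop :=
  (forall z : R[i], eigenvalue V z -> 0 < Im z) /\
  (forall b : R[i],
     symbol2 (toC A11) (toC A12) 1 b
     = ((conjmx V)^T - b%:M) *m (V - b%:M)).

Definition root_decomposition (V : 'M[R[i]]_l) (S D : 'M[R]_l) : Prop :=
  [/\ S^T = S, posdefmx D & V = (toC S + 'i%:M) *m toC D].

Definition posdef_sqrt (D Dh : 'M[R]_l) : Prop :=
  posdefmx Dh /\ Dh *m Dh = D.

End Tuples.

Section ComplexPowers.
Variable R : realType.
Implicit Types z lam : R[i].

Definition cexp z : R[i] :=
  (expR (Re z) * cos (Im z)) +i* (expR (Re z) * sin (Im z)).

(* [acos] takes its values in [0, pi]; see [argpP] and [argmP] below. *)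
Definition argp z : R :=
  if 0 <= Im z then acos (Re z / normc z)
  else 2 * pi - acos (Re z / normc z).

Definition argm z : R :=
  if Im z <= 0 then - acos (Re z / normc z)
  else acos (Re z / normc z) - 2 * pi.

Definition logp z : R[i] := ln (normc z) +i* argp z.
Definition logm z : R[i] := ln (normc z) +i* argm z.

Definition cpowp lam z : R[i] := cexp (lam * logp z).
Definition cpowm lam z : R[i] := cexp (lam * logm z).

Definition rpow lam (r : R) : R[i] := cexp (lam * (ln r)%:C).

End ComplexPowers.

Section FunctionalCalculus.
Variable R : realType.

Definition cintegral (a b : R) (g : R -> R[i]) : R[i] :=
  (\int[lebesgue_measure]_(t in `[a, b]) Re (g t))%R +i*
  (\int[lebesgue_measure]_(t in `[a, b]) Im (g t))%R.

Definition circle_integral (mu : R[i]) (rho : R) (g : R[i] -> R[i]) : R[i] :=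
  cintegral 0 (2 * pi) (fun t =>
    g (mu + rho%:C * cexp (t *i)) * (rho%:C * 'i * cexp (t *i))).

(* (2 pi i)^-1 times the integral of f(z) (z - X)^-1 over the union of the
   positively oriented circles of radius [rho] around the points of the
   spectrum of X. *)
Definition dunford (l : nat) (rho : R) (f : R[i] -> R[i]) (X : 'M[R[i]]_l) :
    'M[R[i]]_l :=
  \matrix_(i, j) ((2 * (pi : R)%:C * 'i)^-1 *
    \sum_(mu \in [set mu : R[i] | eigenvalue X mu])
      circle_integral mu rho (fun z => f z * invmx (z%:M - X) i j)).

(* For f holomorphic around the spectrum of X, [dunford rho f X] does not depend
   on rho for all sufficiently small rho > 0 (the closed discs are then disjoint
   and contained in the domain of f); f(X) is this common value. *)
Definition hfc (l : nat) (f : R[i] -> R[i]) (X : 'M[R[i]]_l) : 'M[R[i]]_l :=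
  xget 0 [set M | \forall rho \near (0 : R)^'+, dunford rho f X = M].

End FunctionalCalculus.

Section ModelProblem.
Variable R : realType.
Variable l : nat.
Implicit Types (u : R -> R -> 'cV[R[i]]_l) (v w : R -> 'cV[R[i]]_l).

Definition vderive w (t : R) : 'cV[R[i]]_l :=
  \col_k ((fun s => Re (w s k 0))^`()%classic t +i*
          (fun s => Im (w s k 0))^`()%classic t).

(* A C^oo function on [0, alpha] is the restriction of a C^oo function on the
   line; only the values on [0, alpha] matter in [mixed_solution]. *)
Definition smooth_vec v : Prop :=
  forall (n : nat) (k : 'I_l) (t : R),
    derivable ((fun s => Re (v s k 0))^`(n)%classic) t 1 /\
    derivable ((fun s => Im (v s k 0))^`(n)%classic) t 1.

(* The Cartesian partial derivatives d/dx_1 (j = 0) and d/dx_2 (j = 1) of a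
   function given in polar coordinates; see [partial_xP]. *)
Definition partial_x (j : 'I_2) u : R -> R -> 'cV[R[i]]_l :=
  fun r phi =>
    let ur := vderive (fun s => u s phi) r in
    let uphi := vderive (fun s => u r s) phi in
    if j == 0 then (cos phi)%:C *: ur - (sin phi / r)%:C *: uphi
    else (sin phi)%:C *: ur + (cos phi / r)%:C *: uphi.

Definition elliptic_op (A11 A12 : 'M[R]_l) u : R -> R -> 'cV[R[i]]_l :=
  fun r phi => \sum_(i < 2) \sum_(j < 2)
    toC (tuple_coef A11 A12 i j) *m partial_x i (partial_x j u) r phi.

Definition normal (phi : R) (i : 'I_2) : R :=
  if i == 0 then - sin phi else cos phi.

Definition conormal (A11 A12 : 'M[R]_l) u (r phi : R) : 'cV[R[i]]_l :=
  \sum_(i < 2) \sum_(j < 2)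
    (normal phi i)%:C *: (toC (tuple_coef A11 A12 i j) *m partial_x j u r phi).

Definition power_fun (lam : R[i]) v : R -> R -> 'cV[R[i]]_l :=
  fun r phi => rpow lam r *: v phi.

Definition mixed_solution (A11 A12 : 'M[R]_l) (alpha : R) (lam : R[i]) v :
    Prop :=
  let u := power_fun lam v in
  [/\ smooth_vec v,
      (forall r phi : R, 0 < r -> 0 <= phi <= alpha ->
         elliptic_op A11 A12 u r phi = 0),
      (forall r : R, 0 < r -> conormal A11 A12 u r 0 = 0),
      (forall r : R, 0 < r -> u r alpha = 0) &
      exists r phi : R, [/\ 0 < r, 0 <= phi <= alpha & u r phi != 0]].

End ModelProblem.

(* [Dh] stands for D^(1/2), see [posdef_sqrt]. *)
Section Matrices.
Variable R : realType.
Variable l : nat.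

Definition mxcomm (X Y : 'M[R]_l) : 'M[R]_l := X *m Y - Y *m X.

Definition Zmx (S D Dh : 'M[R]_l) (alpha : R) : 'M[R[i]]_l :=
  (cos alpha)%:C%:M + (sin alpha)%:C *: toC (Dh *m S *m Dh)
  + ('i * (sin alpha)%:C) *: toC D.

Definition Mmx (S D Dh : 'M[R]_l) (lam : R[i]) (alpha : R) : 'M[R[i]]_l :=
  let Z := Zmx S D Dh alpha in
  let Zp := hfc (cpowp lam) Z in
  let Zm := hfc (cpowm lam) (conjmx Z) in
  2^-1 *: (toC (mxcomm (invmx Dh *m S *m invmx Dh) D) *m (Zp - Zm))
  + 'i *: (Zp + Zm).

End Matrices.

Section Facts.
Variable R : realType.

Lemma normc_gt0 (z : R[i]) : z != 0 -> 0 < normc z.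
Proof.
move=> z0; rewrite lt_def; apply/andP; split; last first.
  by case: (z) => a b; apply: sqrtr_ge0.
by apply: contra z0 => /eqP /eq0_normc ->.
Qed.

Let z_cos (z : R[i]) : z != 0 ->
  [/\ -1 <= Re z / normc z <= 1, Re z = normc z * cos (acos (Re z / normc z)) &
      `|Im z| = normc z * sin (acos (Re z / normc z))].
Proof.
move=> z0; have n0 := normc_gt0 z0.
have n0' : normc z != 0 by rewrite gt_eqF.
have nE : normc z ^+ 2 = Re z ^+ 2 + Im z ^+ 2.
  by case: (z) => a b /=; rewrite sqr_sqrtr// addr_ge0 ?sqr_ge0.
have h : -1 <= Re z / normc z <= 1.
  rewrite -ler_norml normrM normfV (gtr0_norm n0) ler_pdivrMr// mul1r.
  rewrite -(@ler_pXn2r _ 2)// ?nnegrE ?normr_ge0 ?(ltW n0)//.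
  by rewrite real_normK ?num_real// nE lerDl sqr_ge0.
split => //; first by rewrite acosK// mulrC divfK.
rewrite sin_acos//.
apply/eqP; rewrite -(@eqrXn2 _ 2)// ?mulr_ge0 ?sqrtr_ge0 ?(ltW n0)//.
rewrite real_normK ?num_real// exprMn sqr_sqrtr; last first.
  rewrite subr_ge0 -[leRHS](expr1n _ 2) -(real_normK (num_real _)).
  by rewrite lerXn2r ?nnegrE ?ler_norml.
by rewrite mulrBr mulr1 expr_div_n mulrC divfK ?expf_neq0// nE addrC addKr.
Qed.

Lemma argpP (z : R[i]) : z != 0 ->
  0 <= argp z < 2 * pi /\ z = (normc z)%:C * cexp ((argp z) *i).
Proof.
move=> z0; have [h hR hI] := z_cos z0; have n0 := normc_gt0 z0.
have a0 := acos_ge0 h; have api := acos_lepi h; have pi0 := pi_gt0 R.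
have e2pi : 2 * pi = pi *+ 2 :> R by rewrite mulr_natl.
rewrite /argp; set c := acos _ in hR hI a0 api *.
case: ifPn => [I0|]; last rewrite -ltNge => I0.
  rewrite (ger0_norm I0) in hI; split; first by rewrite a0 /=; lra.
  rewrite /cexp /= expR0 !mul1r {1}(_ : z = Re z +i* Im z); last by case: (z).
  by apply/eqP; rewrite eq_complex /= !mul0r subr0 addr0 -hR -hI !eqxx.
rewrite (ltr0_norm I0) in hI.
have c0 : 0 < c.
  rewrite lt_def a0 andbT; apply/eqP => c0.
  by move: hI I0; rewrite c0 sin0 mulr0 => /eqP; rewrite oppr_eq0 => /eqP ->; rewrite ltxx.
split; first by apply/andP; split; lra.
rewrite /cexp /= expR0 !mul1r {1}(_ : z = Re z +i* Im z); last by case: (z).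
rewrite addrC e2pi cosD2pi sinD2pi cosN sinN.
by apply/eqP; rewrite eq_complex /= !mul0r subr0 addr0 mulrN -hR -hI opprK !eqxx.
Qed.

Lemma argmP (z : R[i]) : z != 0 ->
  - (2 * pi) < argm z <= 0 /\ z = (normc z)%:C * cexp ((argm z) *i).
Proof.
move=> z0; have [h hR hI] := z_cos z0; have n0 := normc_gt0 z0.
have a0 := acos_ge0 h; have api := acos_lepi h; have pi0 := pi_gt0 R.
have e2pi : 2 * pi = pi *+ 2 :> R by rewrite mulr_natl.
rewrite /argm; set c := acos _ in hR hI a0 api *.
case: ifPn => [I0|]; last rewrite -ltNge => I0.
  rewrite (ler0_norm I0) in hI; split; first by apply/andP; split; lra.
  rewrite /cexp /= expR0 !mul1r {1}(_ : z = Re z +i* Im z); last by case: (z).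
  rewrite cosN sinN.
  by apply/eqP; rewrite eq_complex /= !mul0r subr0 addr0 mulrN -hR -hI opprK !eqxx.
rewrite (gtr0_norm I0) in hI.
have c0 : 0 < c.
  rewrite lt_def a0 andbT; apply/eqP => c0.
  by move: hI I0; rewrite c0 sin0 mulr0 => ->; rewrite ltxx.
split; first by apply/andP; split; lra.
rewrite /cexp /= expR0 !mul1r {1}(_ : z = Re z +i* Im z); last by case: (z).
rewrite -cosD2pi -sinD2pi e2pi subrK.
by apply/eqP; rewrite eq_complex /= !mul0r subr0 addr0 -hR -hI !eqxx.
Qed.

Let derive_curve (F : R * R -> R) (f g : R -> R) (t a b : R) :
  is_derive t 1 f a -> is_derive t 1 g b -> differentiable F (f t, g t) ->
  (fun s => F (f s, g s))^`()%classic t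
  = a * 'D_(1, 0) F (f t, g t) + b * 'D_(0, 1) F (f t, g t).
Proof.
move=> [df ef] [dg eg] dF.
have /derivable1_diffP Df := df; have /derivable1_diffP Dg := dg.
have Dp : differentiable (fun s => (f s, g s)) t by exact: differentiable_pair.
have DFp : differentiable (F \o (fun s => (f s, g s))) t.
  exact: differentiable_comp.
rewrite (derive1E' DFp) (diff_comp Dp dF) /= (diff_pair Df Dg) /=.
rewrite -(deriveE (1 : R) Df) -(deriveE (1 : R) Dg) ef eg.
rewrite (deriveE ((1, 0) : R * R) dF) (deriveE ((0, 1) : R * R) dF).
have -> : (a, b) = a *: ((1, 0) : R * R) + b *: ((0, 1) : R * R).
  by congr (_, _) => /=; rewrite ?scaler0 ?addr0 ?add0r /GRing.scale /= mulr1.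
by rewrite linearD !linearZ.
Qed.

Lemma partial_xP (l : nat) (U : R * R -> 'cV[R[i]]_l) (r phi : R) (j : 'I_2) :
  let p := (r * cos phi, r * sin phi) in
  let e : R * R := if j == 0 then (1, 0) else (0, 1) in
  0 < r ->
  (forall k, differentiable (fun x => Re (U x k 0)) p /\
             differentiable (fun x => Im (U x k 0)) p) ->
  partial_x j (fun s t => U (s * cos t, s * sin t)) r phi
  = \col_k ('D_e (fun x => Re (U x k 0)) p +i* 'D_e (fun x => Im (U x k 0)) p).
Proof.
move=> p e r0 dU.
have r_neq0 : r != 0 by rewrite gt_eqF.
have drad (F : R * R -> R) : differentiable F p ->
    (fun s => F (s * cos phi, s * sin phi))^`()%classic r
    = cos phi * 'D_(1, 0) F p + sin phi * 'D_(0, 1) F p.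
  apply: (@derive_curve F (fun s => s * cos phi) (fun s => s * sin phi)).
    by apply: is_derive_eq; rewrite /GRing.scale /= mulr0 add0r mulr1.
  by apply: is_derive_eq; rewrite /GRing.scale /= mulr0 add0r mulr1.
have dang (F : R * R -> R) : differentiable F p ->
    (fun t => F (r * cos t, r * sin t))^`()%classic phi
    = - (r * sin phi) * 'D_(1, 0) F p + r * cos phi * 'D_(0, 1) F p.
  apply: (@derive_curve F (fun t => r * cos t) (fun t => r * sin t)).
  by apply: is_derive_eq; rewrite /GRing.scale /= mulrN.
apply/colP => k; have [dR dI] := dU k.
have c2 : cos phi ^+ 2 = 1 - sin phi ^+ 2 by exact: cos2sin2.
have {drad} [eR eI] := (drad _ dR, drad _ dI).
have {dang} [fR fI] := (dang _ dR, dang _ dI).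
rewrite /partial_x /e; case: ifP => _; rewrite !mxE eR eI fR fI.
  move: ('D__ _ p) ('D__ _ p) ('D__ _ p) ('D__ _ p) (cos phi) (sin phi) c2.
  move=> a1 b1 a2 b2 c s c2; apply/eqP; rewrite eq_complex /=.
  by apply/andP; split; apply/eqP; field : c2; exact: r_neq0.
move: ('D__ _ p) ('D__ _ p) ('D__ _ p) ('D__ _ p) (cos phi) (sin phi) c2.
move=> a1 b1 a2 b2 c s c2; apply/eqP; rewrite eq_complex /=.
by apply/andP; split; apply/eqP; field : c2; exact: r_neq0.
Qed.

End Facts.

(* Main.v *)
Require Import Defs.
From mathcomp Require Import all_boot all_order all_algebra.
From mathcomp Require Import all_classical all_reals all_analysis.
From mathcomp Require Import complex ring lra.

Set Implicit Arguments.
Unset Strict Implicit.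
Unset Printing Implicit Defensive.

Import Order.TTheory GRing.Theory Num.Theory.
Import numFieldNormedType.Exports.
Import Normc.
Local Open Scope classical_set_scope.
Local Open Scope ring_scope.
Local Open Scope complex_scope.

(** Since [V] is the standard root, [A11 = V* V] and [2 A12 = - (V* + V)], so that
    [L_A = (V* d1 - d2) (V d1 - d2)] with commuting constant-coefficient factors.  Write
    [P(t) = cos t + sin t V], which is the value of [x1 + x2 V] on the unit circle.  The
    spectrum of [V] lies in the open upper half-plane, hence the powers [P(t)^lam] can be
    followed continuously in [t], starting from the identity at [t = 0].  The function
    [r^lam P(t)^lam c] is killed by the right factor, and because the [A_ij] are real the
    same construction with the conjugate of [V] also gives solutions.  As
    [V - conj V = 2 i D] is invertible and [lam != 0], the Cauchy data at [t = 0] of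
    [P^lam c + conj(P)^lam c'] are arbitrary; and a solution with zero Cauchy data vanishes
    ([angular_op_uniq]), because each factor is a first-order system
    [P y' = a P' y], for which [P^(-a) y] is constant.  So these are all the solutions
    ([solution_space]).

    The conormal condition becomes [K s + i d = 0] for [s = D^(1/2) (c + c')],
    [d = D^(1/2) (c - c')] and [K] half the commutator of the theorem.  Inserting
    [d = i K s] into the Dirichlet condition leaves one linear equation for [s]
    ([boundary_conditions]), whose matrix is the transpose of [M]: [K] is skew and the
    powers of the symmetric matrix [Z] are symmetric ([Mmx_tr]).  A column [s] killed by
    the transpose of [M] is a left null vector of [M].

    It remains to identify [D^(1/2) P(alpha)^lam D^(-1/2)] with the power of [Z] given by the
    holomorphic functional calculus ([pencil_powers_exist]).  With the spectral projections
    [E mu] of [V], the followed power is the finite Taylor sum of binomial terms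
    [cbin lam k p^(lam - k) (sin t)^k (V - mu)^k E mu], [p = cos t + mu sin t], where the
    powers of [p] come from a logarithm [plog mu] of [p] along the line.  The imaginary part
    of [plog mu] increases from 0 to [2 pi] on a period, so it is the argument in
    [[0, 2 pi)] for [0 < t < 2 pi] ([logp_pen]).  On the other side the resolvent has a
    partial fraction expansion with the same matrices, and the contour integrals of
    [z^lam (z - m)^(-k-1)] over small circles are computed from two facts: a circle average
    of a holomorphic function does not depend on the radius ([mean_value]), and integration
    by parts lowers [k] ([circle_integral_powS]). *)

Local Notation Re := complex.Re.
Local Notation Im := complex.Im.
Local Notation conjmx := Defs.conjmx.

(** * Derivatives of complex curves *)

Section CurveDerivative.
Variable R : realType.
Implicit Types (f g : R -> R[i]) (t : R).

Lemma cReM (z w : R[i]) : Re (z * w) = Re z * Re w - Im z * Im w.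
Proof. by case: z; case: w. Qed.
Lemma cImM (z w : R[i]) : Im (z * w) = Re z * Im w + Im z * Re w.
Proof. by case: z; case: w. Qed.
Lemma cReD (z w : R[i]) : Re (z + w) = Re z + Re w.
Proof. by case: z; case: w. Qed.
Lemma cImD (z w : R[i]) : Im (z + w) = Im z + Im w.
Proof. by case: z; case: w. Qed.
Lemma cReN (z : R[i]) : Re (- z) = - Re z.
Proof. by case: z. Qed.
Lemma cImN (z : R[i]) : Im (- z) = - Im z.
Proof. by case: z. Qed.
Lemma cReV (z : R[i]) : Re z^-1 = Re z / (Re z ^+ 2 + Im z ^+ 2).
Proof. by case: z. Qed.
Lemma cImV (z : R[i]) : Im z^-1 = - (Im z / (Re z ^+ 2 + Im z ^+ 2)).
Proof. by case: z. Qed.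

Lemma conjD (z w : R[i]) : conjc (z + w) = conjc z + conjc w.
Proof. exact: rmorphD. Qed.
Lemma conjM (z w : R[i]) : conjc (z * w) = conjc z * conjc w.
Proof. exact: rmorphM. Qed.

Definition cE := (cReM, cImM, cReD, cImD, cReN, cImN, cReV, cImV).

Lemma complex_ext (z w : R[i]) : Re z = Re w -> Im z = Im w -> z = w.
Proof. by case: z => a b; case: w => c d /= -> ->. Qed.

Lemma sqr_norm_gt0 (z : R[i]) : z != 0 -> 0 < Re z ^+ 2 + Im z ^+ 2.
Proof.
case: z => a b; rewrite eq_complex /= => h.
rewrite lt_def addr_ge0 ?sqr_ge0// andbT; apply: contra h.
by rewrite paddr_eq0 ?sqr_ge0// !sqrf_eq0.
Qed.

(** Complex-valued functions are only ever differentiated along real curves; a complex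
    derivative appears as a chain rule for all curves, see [holo]. *)
Definition cder f t (d : R[i]) : Prop :=
  is_derive t 1 (fun s => Re (f s)) (Re d) /\
  is_derive t 1 (fun s => Im (f s)) (Im d).

Lemma cder_eq f t d d' : cder f t d -> d = d' -> cder f t d'.
Proof. by move=> + <-. Qed.

Lemma cder_cst c t : cder (fun=> c) t 0.
Proof. by split; exact: is_derive_cst. Qed.

Lemma cderD f g t df dg :
  cder f t df -> cder g t dg -> cder (fun s => f s + g s) t (df + dg).
Proof.
move=> [fr fi] [gr gi]; split.
  under eq_fun do rewrite cReD.
  by rewrite cReD; apply: is_deriveD.
under eq_fun do rewrite cImD.
by rewrite cImD; apply: is_deriveD.
Qed.

Lemma cderN f t df : cder f t df -> cder (fun s => - f s) t (- df).
Proof.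
move=> [fr fi]; split.
  under eq_fun do rewrite cReN.
  by rewrite cReN; apply: is_deriveN.
under eq_fun do rewrite cImN.
by rewrite cImN; apply: is_deriveN.
Qed.

Lemma cderM f g t df dg :
  cder f t df -> cder g t dg -> cder (fun s => f s * g s) t (df * g t + f t * dg).
Proof.
move=> [fr fi] [gr gi]; split.
  under eq_fun do rewrite cReM.
  apply: (is_derive_eq (is_deriveB (is_deriveM fr gr) (is_deriveM fi gi))).
  by rewrite !cE /GRing.scale/=; ring.
under eq_fun do rewrite cImM.
apply: (is_derive_eq (is_deriveD (is_deriveM fr gi) (is_deriveM fi gr))).
by rewrite !cE /GRing.scale/=; ring.
Qed.

Lemma cderV f t df :
  cder f t df -> f t != 0 -> cder (fun s => (f s)^-1) t (- df / f t ^+ 2).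
Proof.
move=> [fr fi] ft0; have n0 := sqr_norm_gt0 ft0.
have n0' : Re (f t) ^+ 2 + Im (f t) ^+ 2 != 0 by rewrite gt_eqF.
have n0'' : (Re (f t) * Re (f t) - Im (f t) * Im (f t)) ^+ 2 +
  (Re (f t) * Im (f t) + Im (f t) * Re (f t)) ^+ 2 != 0.
  rewrite (_ : _ + _ = (Re (f t) ^+ 2 + Im (f t) ^+ 2) ^+ 2); last by ring.
  by rewrite expf_neq0.
have nV := @is_deriveV R _ t _ 1 n0' (is_deriveD (is_deriveX 2 fr) (is_deriveX 2 fi)).
split.
  under eq_fun do rewrite cReV.
  apply: (is_derive_eq (is_deriveM fr nV)).
  rewrite /GRing.scale/= !fctE expr2 !cE.
  by field; rewrite ?n0' ?n0''.
under eq_fun do rewrite cImV -mulNr.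
apply: (is_derive_eq (is_deriveM (is_deriveN fi) nV)).
rewrite /GRing.scale/= !fctE expr2 !cE.
by field; rewrite ?n0' ?n0''.
Qed.

Lemma cder_conj f t d : cder f t d -> cder (fun s => conjc (f s)) t (conjc d).
Proof.
move=> [fr fi]; split.
  have -> : (fun s => Re (conjc (f s))) = (fun s => Re (f s)) by apply/funext => s; case: (f s).
  by case: (d) fr.
have -> : (fun s => Im (conjc (f s))) = - (fun s => Im (f s)).
  by apply/funext => s; rewrite fctE; case: (f s).
by have := is_deriveN fi; case: (d).
Qed.

Lemma cder_real (h : R -> R) t d : is_derive t 1 h d -> cder (fun s => (h s)%:C) t d%:C.
Proof. by move=> hd; split => //=; exact: is_derive_cst. Qed.

Lemma cder_im (h : R -> R) t d : is_derive t 1 h d -> cder (fun s => (h s)*i) t (d *i).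
Proof. by move=> hd; split => //=; exact: is_derive_cst. Qed.

Lemma cder_sum (I : Type) (r : seq I) (F : I -> R -> R[i]) (dF : I -> R[i]) t :
  (forall i, cder (F i) t (dF i)) ->
  cder (fun s => \sum_(i <- r) F i s) t (\sum_(i <- r) dF i).
Proof.
move=> h; elim: r => [|i r IH].
  by rewrite big_nil; under eq_fun do rewrite big_nil; exact: cder_cst.
rewrite big_cons; under eq_fun do rewrite big_cons.
exact: cderD.
Qed.

Lemma cder_exp f t d : cder f t d -> cder (fun s => cexp (f s)) t (d * cexp (f t)).
Proof.
move=> [fr fi]; have er := is_derive1_comp (is_derive_expR _) fr.
split.
  have h := is_deriveM er (is_derive1_comp (is_derive_cos _) fi).
  by apply: (is_derive_eq h); rewrite cE /GRing.scale/=; ring.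
have h := is_deriveM er (is_derive1_comp (is_derive_sin _) fi).
by apply: (is_derive_eq h); rewrite cE /GRing.scale/=; ring.
Qed.

Lemma cderMc f t d c : cder f t d -> cder (fun s => c * f s) t (c * d).
Proof. by move=> h; apply: (cder_eq (cderM (cder_cst c t) h)); ring. Qed.

Lemma cderX f t d n :
  cder f t d -> cder (fun s => f s ^+ n) t (n%:R * f t ^+ n.-1 * d).
Proof.
move=> h; elim: n => [|n IH].
  by apply: (cder_eq (cder_cst 1 t)); rewrite !mul0r.
under eq_fun do rewrite exprS.
apply: (cder_eq (cderM h IH)); rewrite /= -natr1.
by case: n {IH} => [|n] /=; rewrite ?expr0 ?exprS; ring.
Qed.

Lemma cder_near f g t d : (\forall s \near t, f s = g s) -> cder f t d -> cder g t d.
Proof.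
move=> fg [fr fi]; split.
  by apply: near_eq_is_derive fr; apply: filterS fg => s ->.
by apply: near_eq_is_derive fi; apply: filterS fg => s ->.
Qed.

Lemma cder_derivable f t d : cder f t d ->
  derivable (fun s => Re (f s)) t 1 /\ derivable (fun s => Im (f s)) t 1.
Proof. by move=> [[? _] [? _]]. Qed.

Lemma cder_uniq f t d d' : cder f t d -> cder f t d' -> d = d'.
Proof.
by move=> [[_ a] [_ b]] [[_ a'] [_ b']]; apply: complex_ext; [rewrite -a -a'|rewrite -b -b'].
Qed.

Lemma cder0_cst_on f (a b : R) : (forall t, a <= t <= b -> cder f t 0) ->
  forall t, a <= t <= b -> f t = f a.
Proof.
move=> h t /andP[]; rewrite le_eqVlt => /predU1P[->//|at_ tb].
have key (g : R -> R) : (forall s, a <= s <= b -> is_derive s 1 g 0) -> g t = g a.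
  move=> dg.
  have in1 s : s \in `]a, t[%R -> is_derive s 1 g 0.
    by rewrite in_itv/= => /andP[? ?]; apply: dg; lra.
  have ct : {within `[a, t], continuous g}.
    apply: derivable_within_continuous => s; rewrite in_itv/= => /andP[? ?].
    by have [] : is_derive s 1 g 0 by apply: dg; lra.
  have [c _ /eqP] := MVT at_ in1 ct.
  by rewrite mul0r subr_eq0 => /eqP.
apply: complex_ext; [apply: (key (fun s => Re (f s)))|apply: (key (fun s => Im (f s)))].
- by move=> s /h[].
- by move=> s /h[].
Qed.

End CurveDerivative.

(** * The principal logarithm and the branches of the powers *)

Section Logarithm.
Variable R : realType.
Implicit Types (z w L nu a : R[i]) (f : R -> R[i]) (t : R).

Lemma cexpD z w : cexp (z + w) = cexp z * cexp w.
Proof.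
by apply: complex_ext; rewrite !cE /= !cE expRD ?cosD ?sinD; ring.
Qed.

Lemma cexp0 : cexp 0 = 1 :> R[i].
Proof. by apply: complex_ext; rewrite /= expR0 ?cos0 ?sin0 mul1r. Qed.

Lemma cexp_neq0 z : cexp z != 0.
Proof.
apply/negP => /eqP h; have := cexpD z (- z).
by rewrite subrr cexp0 h mul0r => /eqP; rewrite oner_eq0.
Qed.

Lemma cexpN z : cexp (- z) = (cexp z)^-1.
Proof.
apply: (mulfI (cexp_neq0 z)).
by rewrite -cexpD subrr cexp0 divff// cexp_neq0.
Qed.

Lemma cexp_conj z : cexp (conjc z) = conjc (cexp z).
Proof. by case: z => x y; apply: complex_ext; rewrite /= ?cosN ?sinN ?mulrN. Qed.

Lemma normc_ReIm z : normc z = Num.sqrt (Re z ^+ 2 + Im z ^+ 2).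
Proof. by case: z. Qed.

Lemma normc_cexp z : normc (cexp z) = expR (Re z).
Proof.
rewrite normc_ReIm /= !exprMn -mulrDr cos2Dsin2 mulr1 sqrtr_sqr ger0_norm ?expR_ge0//.
Qed.

Lemma normc_conj z : normc (conjc z) = normc z.
Proof. by case: z => x y /=; rewrite sqrrN. Qed.

(** The principal logarithm of the right half-plane. *)
Definition Log w : R[i] :=
  (2^-1 * ln (Re w ^+ 2 + Im w ^+ 2)) +i* atan (Im w / Re w).

(** With [e = |w|] and [c], [s] the cosine and sine of the argument, [s = (Im w / Re w) c]
    by the choice of the argument, and squaring [e c = Re w] reduces it to [c^2 + s^2 = 1]. *)
Lemma cexp_Log w : 0 < Re w -> cexp (Log w) = w.
Proof.
case: w => a b /= a0; have a0' : a != 0 by rewrite gt_eqF.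
have n0 : 0 < a ^+ 2 + b ^+ 2.
  by rewrite ltr_pwDl ?sqr_ge0// exprn_gt0.
rewrite /cexp /Log /=.
set e := expR _; set c := cos _; set s := sin _.
have e2 : e ^+ 2 = a ^+ 2 + b ^+ 2.
  by rewrite -expRM_natl mulrA mulfV ?mul1r ?lnK// pnatr_eq0.
have e0 : 0 < e by exact: expR_gt0.
have c0 : 0 < c by apply: cos_gt0_pihalf; rewrite atan_gtNpi2 atan_ltpi2.
have sE : s = b / a * c.
  by have := atanK (b / a); rewrite /tan -/s -/c => <-; rewrite mulfVK// gt_eqF.
have c2 : c ^+ 2 + s ^+ 2 = 1 by exact: cos2Dsin2.
have ec : e * c = a.
  apply/eqP; rewrite -(@eqrXn2 _ 2) ?mulr_ge0 ?ltW//; apply/eqP.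
  transitivity (a ^+ 2 * (c ^+ 2 + s ^+ 2)); last by rewrite c2 mulr1.
  by rewrite exprMn e2 sE; field.
by rewrite ec sE mulrCA ec mulfVK.
Qed.

Lemma cder_Log f t d : cder f t d -> 0 < Re (f t) ->
  cder (fun s => Log (f s)) t (d / f t).
Proof.
move=> [fr fi] r0; have r0' : Re (f t) != 0 by rewrite gt_eqF.
have n0 : 0 < ((fun s => Re (f s)) ^+ 2 + (fun s => Im (f s)) ^+ 2) t.
  by rewrite !fctE ltr_pwDl ?sqr_ge0// exprn_gt0.
have n0' : Re (f t) ^+ 2 + Im (f t) ^+ 2 != 0 by rewrite gt_eqF.
split.
  have h := is_derive1_comp (is_derive1_ln n0)
    (is_deriveD (is_deriveX 2 fr) (is_deriveX 2 fi)).
  apply: (is_derive_eq (is_deriveM (is_derive_cst (2^-1 : R) t 1) h)).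
  by rewrite !cE /GRing.scale/= !fctE expr1; field.
have q := is_deriveM fi (is_deriveV r0' fr).
apply: (is_derive_eq (is_derive1_comp (is_derive1_atan _) q)).
rewrite !cE /GRing.scale/= !fctE; by field; rewrite r0' n0'.
Qed.

Lemma Log_conj w : Log (conjc w) = conjc (Log w).
Proof. by case: w => a b; apply: complex_ext; rewrite /= ?sqrrN// mulNr atanN. Qed.

Lemma cos_eq1 (x : R) : `|x| < 2 * pi -> cos x = 1 -> x = 0.
Proof.
move=> x2 cx; have [//|x0] := eqVneq x 0.
have n0 : 0 < `|x| by rewrite normr_gt0.
have s0 : 0 < sin (`|x| / 2) by apply: sin_gt0_pi; apply/andP; split; lra.
have: cos `|x| = 1 by case: (ger0P x) => _ //; rewrite cosN.
have -> : `|x| = (`|x| / 2) *+ 2 by rewrite -mulr_natr divfK// pnatr_eq0.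
rewrite cos_mulr2n cos2sin2 -mulr_natr => h.
have /eqP : sin (`|x| / 2) ^+ 2 = 0 by lra.
by rewrite sqrf_eq0 => /eqP h'; rewrite h' ltxx in s0.
Qed.

(** Two logarithms of [z] with imaginary parts in [[0, 2 pi)] have equal cosines and sines of
    these parts, whose difference is less than [2 pi]. *)
Lemma logp_uniq L z : cexp L = z -> 0 <= Im L < 2 * pi -> logp z = L.
Proof.
move=> Lz /andP[L0 L2]; have z0 : z != 0 by rewrite -Lz cexp_neq0.
have [/andP[p0 p2] zE] := argpP z0.
have nz : normc z = expR (Re L) by rewrite -Lz normc_cexp.
have e0 : expR (Re L) != 0 by rewrite gt_eqF// expR_gt0.
apply: complex_ext => /=; first by rewrite nz expRK.
move: zE; rewrite nz -{1}Lz => /eqP; rewrite eq_complex !cE /= expR0 !mul0r !mul1r subr0 addr0.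
move=> /andP[/eqP /(mulfI e0) ec /eqP /(mulfI e0) es].
apply/eqP; rewrite -subr_eq0; apply/eqP; apply: cos_eq1.
  by rewrite ltr_norml; apply/andP; split; lra.
by rewrite cosB -ec -es -!expr2 cos2Dsin2.
Qed.

(** The branch [cpowm] is obtained from [cpowp] by complex conjugation, so that
    only one of the two branches has to be studied. *)
Lemma logm_conj z : logm z = conjc (logp (conjc z)).
Proof.
case: z => x y; apply: complex_ext; rewrite /= ?sqrrN// /argm /argp /= sqrrN.
by rewrite oppr_ge0; case: ifP => _; rewrite ?opprB.
Qed.

Lemma cpowm_conj a z : cpowm a z = conjc (cpowp (conjc a) (conjc z)).
Proof. by rewrite /cpowm /cpowp logm_conj -cexp_conj rmorphM/= conjcK. Qed.

Lemma Re_ge_normc (z : R[i]) : - normc z <= Re z <= normc z.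
Proof.
rewrite -ler_norml normc_ReIm -sqrtr_sqr; apply: ler_wsqrtr.
by rewrite lerDl sqr_ge0.
Qed.

Lemma Im_ge_normc (z : R[i]) : - normc z <= Im z <= normc z.
Proof.
rewrite -ler_norml normc_ReIm -sqrtr_sqr; apply: ler_wsqrtr.
by rewrite lerDr sqr_ge0.
Qed.

Lemma atan_small (eta : R) : 0 < eta ->
  exists2 e : R, 0 < e & forall x, `|x| < e -> `|atan x| < eta.
Proof.
move=> eta0; have /cvgrPdist_lt /(_ _ eta0) := @continuous_atan R 0.
rewrite atan0 => -[e /= e0 h]; exists e => // x xe.
have := h x; rewrite /= sub0r normrN => /(_ xe).
by rewrite sub0r normrN.
Qed.

(** Near [nu] the family [f a] of powers is the one transported from the
    principal branch near [1]. *)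
Definition local_power (f : R[i] -> R[i] -> R[i]) nu : Prop :=
  [/\ nu != 0, (forall a, f (a - 1) nu = f a nu / nu) &
    exists2 delta : R, 0 < delta & forall z, normc (z - nu) < delta ->
      1 / 2 <= Re (z / nu) /\
      forall a, f a z = f a nu * cexp (a * Log (z / nu))].

(** [logp nu + Log (z / nu)] is a logarithm of [z]; for [z] close to [nu] its imaginary part
    stays in [(0, 2 pi)] because [argp nu] lies there. *)
Lemma cpowp_local nu : nu != 0 -> 0 < argp nu -> local_power (@cpowp R) nu.
Proof.
move=> nu0 an0; have [/andP[_ an2] nuE] := argpP nu0.
have nn0 := normc_gt0 nu0.
have cexplog z : z != 0 -> cexp (logp z) = z.
  move=> z0; have [_ zE] := argpP z0.
  rewrite [RHS]zE -[normc z]lnK ?posrE ?normc_gt0//.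
  rewrite (_ : (expR _)%:C = cexp (ln (normc z))%:C); last first.
    by apply: complex_ext; rewrite /= ?cos0 ?sin0 ?mulr0 ?mulr1.
  rewrite -cexpD; congr cexp.
  by apply: complex_ext; rewrite !cE/= ?addr0 ?add0r ?lnK ?posrE ?normc_gt0.
split=> //.
  by move=> a; rewrite /cpowp mulrBl mul1r cexpD cexpN cexplog.
pose eta := Num.min (argp nu) (2 * pi - argp nu).
have eta0 : 0 < eta by rewrite lt_min an0 subr_gt0.
have [e e0 he] := atan_small eta0.
exists (normc nu * Num.min (1 / 2) (e / 2)).
  by rewrite mulr_gt0// lt_min; apply/andP; split; lra.
move=> z zn; set w := z / nu.
have zw : nu * w = z by rewrite /w; field.
clearbody w.
have wn : normc (w - 1) < Num.min (1 / 2) (e / 2).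
  by rewrite -(ltr_pM2l nn0) -normcM mulrBr mulr1 zw.
move: wn; rewrite lt_min => /andP[w1 w2].
have := Re_ge_normc (w - 1); have := Im_ge_normc (w - 1).
rewrite !cE/= oppr0 addr0 => /andP[i1 i2] /andP[r1 r2].
have rw : 1 / 2 <= Re w by lra.
split=> // a.
have rw0 : 0 < Re w by lra.
rewrite /cpowp -cexpD -mulrDr; congr (cexp (_ * _)).
have zE : cexp (logp nu + Log w) = z by rewrite cexpD cexplog// cexp_Log.
apply: logp_uniq => //=.
have : `|Im w / Re w| < e.
  rewrite normrM normfV (gtr0_norm rw0) ltr_pdivrMr//.
  have: `|Im w| < e / 2 by rewrite ltr_norml; apply/andP; split; lra.
  by move=> h; nra.
move=> /he; rewrite lt_min !ltr_norml => /andP[/andP[h1 h2] /andP[h3 h4]].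
by apply/andP; split; lra.
Qed.

Lemma cpowm_local nu : nu != 0 -> 0 < argp (conjc nu) -> local_power (@cpowm R) nu.
Proof.
move=> nu0 an0; have nuc0 : (conjc nu) != 0 by rewrite conjc_eq0.
have [_ h1 [d d0 h2]] := cpowp_local nuc0 an0; split=> //.
  by move=> a; rewrite !cpowm_conj rmorphB rmorph1 h1 rmorphM /= conjc_inv conjcK.
have cdiv z : (conjc z) / (conjc nu) = conjc (z / nu) by rewrite rmorphM /= conjc_inv.
exists d => // z zn.
have : normc ((conjc z) - (conjc nu)) < d by rewrite -rmorphB normc_conj.
move=> /h2; rewrite cdiv => -[h3 h4]; split.
  by case: (z / nu) h3.
move=> a; rewrite !cpowm_conj h4 Log_conj; move: (Log _) => w.
by rewrite conjM -cexp_conj conjM !conjcK.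
Qed.

End Logarithm.

(** * Integrals of powers over small circles *)

(** The generalized binomial coefficient, defined by the recursion that integration
    by parts produces for Taylor coefficients of powers. *)
Fixpoint cbin (R : realType) (a : R[i]) (k : nat) : R[i] :=
  if k is k'.+1 then a / k%:R * cbin (a - 1) k' else 1.

Section Discs.
Variable R : realType.
Implicit Types (z w nu m : R[i]) (g h : R[i] -> R[i]) (delta rho : R).

(** Complex differentiability on a disc with derivative [g'], tested along curves. *)
Definition holo nu delta g g' : Prop :=
  forall z, normc (z - nu) < delta ->
  forall (c : R -> R[i]) t d, c t = z -> cder c t d ->
    cder (fun s => g (c s)) t (g' z * d).

Variables (f : R[i] -> R[i] -> R[i]) (nu : R[i]) (delta : R).

(** A class of holomorphic functions on the disc that contains the integrands, is closed
    under differentiation and consists of functions bounded on the disc: these are the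
    hypotheses for differentiating under the integral sign.  The poles keep a distance of
    twice the radius from the centre, hence the radius from the disc. *)
Inductive elementary : (R[i] -> R[i]) -> Prop :=
| elem_cst c : elementary (fun=> c)
| elem_id : elementary (fun z => z)
| elem_pow a : elementary (f a)
| elem_inv m of 2 * delta <= normc (m - nu) : elementary (fun z => (z - m)^-1)
| elem_add g h of elementary g & elementary h : elementary (fun z => g z + h z)
| elem_mul g h of elementary g & elementary h : elementary (fun z => g z * h z).

Hypothesis nu0 : nu != 0.
Hypothesis fS : forall a, f (a - 1) nu = f a nu / nu.
Hypothesis delta0 : 0 < delta.
Hypothesis f_local : forall z, normc (z - nu) < delta ->
  1 / 2 <= Re (z / nu) /\
  forall a, f a z = f a nu * cexp (a * Log (z / nu)).

Lemma normc_ge0 z : 0 <= normc z.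
Proof. by rewrite normc_ReIm sqrtr_ge0. Qed.

Lemma normcB_sym z w : normc (z - w) = normc (w - z).
Proof. by rewrite -normcN opprB. Qed.

Lemma elem_inv_far m z : 2 * delta <= normc (m - nu) -> normc (z - nu) < delta ->
  delta <= normc (z - m).
Proof.
move=> h1 h2; have := le_normcD (m - z) (z - nu).
rewrite -[_ + (z - nu)]/((m - z) + (z - nu) : R[i]) addrA subrK (normcB_sym m z) => h3.
by have := le_trans h1 h3; lra.
Qed.

Lemma cder_near_disc (c : R -> R[i]) t d : cder c t d -> normc (c t - nu) < delta ->
  \forall s \near t, normc (c s - nu) < delta.
Proof.
move=> /cder_derivable[/derivable1_diffP /differentiable_continuous cr
  /derivable1_diffP /differentiable_continuous ci] h.
have cn : normc (c s - nu) @[s --> t] --> normc (c t - nu).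
  under eq_fun do rewrite normc_ReIm !cE.
  rewrite normc_ReIm !cE; apply: (@continuous_comp _ _ _
    (fun s => (Re (c s) - Re nu) ^+ 2 + (Im (c s) - Im nu) ^+ 2) Num.sqrt); last first.
    exact: sqrt_continuous.
  apply: cvgD; apply: cvgM; apply: cvgB => //; exact: cvg_cst.
exact: (cvgr_lt _ cn).
Qed.

Lemma holo_pow a : holo nu delta (f a) (fun z => a * f (a - 1) z).
Proof.
move=> z zd c t d cz dc; have [w2 fz] := f_local zd.
have w0 : 0 < Re (z / nu) by apply: lt_le_trans w2; lra.
have z0 : z != 0.
  by apply/negP => /eqP z0; move: w0; rewrite z0 mul0r ltxx.
apply: (@cder_near _ (fun s => f a nu * cexp (a * Log (nu^-1 * c s)))).
  have := cder_near_disc dc; rewrite cz => /(_ zd); apply: filterS => s sd.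
  by have [_ ->] := f_local sd; rewrite mulrC [nu^-1 * _]mulrC mulrC.
have w0' : 0 < Re (nu^-1 * c t) by rewrite cz mulrC.
apply: (cder_eq (cderMc _ (cder_exp (cderMc _ (cder_Log (cderMc _ dc) w0'))))).
rewrite cz !fz fS mulrBl mul1r cexpD cexpN cexp_Log// [nu^-1 * z]mulrC.
by field; rewrite nu0 z0.
Qed.

Lemma elem_holo g : elementary g ->
  exists2 g', elementary g' & holo nu delta g g'.
Proof.
elim=> {g} [c||a|m md|g h _ [g' eg' hg] _ [h' eh' hh]|g h eg [g' eg' hg] eh [h' eh' hh]].
- exists (fun=> 0); first exact: elem_cst.
  by move=> z _ c' t d _ _; rewrite mul0r; exact: cder_cst.
- exists (fun=> 1); first exact: elem_cst.
  by move=> z _ c t d _ dc; rewrite mul1r.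
- exists (fun z => a * f (a - 1) z); last exact: holo_pow.
  by apply: elem_mul; [exact: elem_cst|exact: elem_pow].
- exists (fun z => -1 * ((z - m)^-1 * (z - m)^-1)).
    by apply: elem_mul; [exact: elem_cst|apply: elem_mul; exact: elem_inv].
  move=> z zd c t d cz dc.
  have zm : z - m != 0.
    apply/eqP => zm; have := elem_inv_far md zd; rewrite zm normc0.
    by rewrite leNgt delta0.
  have h := cderD dc (cder_cst (- m) t).
  apply: (cder_eq (cderV h _)); rewrite cz//.
  by field.
- exists (fun z => g' z + h' z); first exact: elem_add.
  move=> z zd c t d cz dc; rewrite mulrDl.
  by apply: cderD; [exact: (hg z)|exact: (hh z)].
- exists (fun z => g' z * h z + g z * h' z).
    by apply: elem_add; apply: elem_mul.
  move=> z zd c t d cz dc.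
  apply: (cder_eq (cderM (hg z zd c t d cz dc) (hh z zd c t d cz dc))).
  by rewrite cz; ring.
Qed.

Definition cbounded (A : R[i] -> Prop) g : Prop :=
  exists B : R, forall z, A z -> normc (g z) <= B.

(** On the disc [z / nu] stays in a compact subset of the right half-plane, which bounds the
    principal logarithm and with it the powers. *)
Lemma elem_bounded g : elementary g -> cbounded (fun z => normc (z - nu) < delta) g.
Proof.
have normcD z w : normc (z + w) <= normc z + normc w by exact: le_normcD.
elim=> {g} [c||a|m md|g h _ [B hB] _ [B' hB']|g h _ [B hB] _ [B' hB']].
- by exists (normc c).
- exists (normc nu + delta) => z /ltW zd; rewrite -[z in leLHS](subrK nu).
  by apply: le_trans (normcD _ _) _; rewrite addrC lerD.
- pose M := (delta / normc nu + 1) ^+ 2.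
  exists (normc (f a nu) * expR (`|Re a| * (`|ln (1 / 4)| + `|ln M|) + `|Im a| * pi)).
  move=> z zd; have [w2 ->] := f_local zd; rewrite normcM normc_cexp.
  apply: ler_wpM2l; first exact: normc_ge0.
  rewrite ler_expR cE /=; set w := z / nu in w2 *.
  have wn : normc w <= delta / normc nu + 1.
    have -> : w = (z - nu) / nu + 1 by rewrite /w; field.
    apply: le_trans (normcD _ _) _; rewrite normcM normcV normc1 lerD2r.
    by apply: ler_wpM2r; rewrite ?invr_ge0 ?normc_ge0// ltW.
  have wE : Re w ^+ 2 + Im w ^+ 2 = normc w ^+ 2.
    by rewrite normc_ReIm sqr_sqrtr// addr_ge0// sqr_ge0.
  have n1 : 1 / 4 <= Re w ^+ 2 + Im w ^+ 2 by have := sqr_ge0 (Im w); nra.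
  have n2 : Re w ^+ 2 + Im w ^+ 2 <= M.
    by rewrite wE /M; apply: lerXn2r; rewrite ?nnegrE ?normc_ge0//; apply: le_trans wn; exact: normc_ge0.
  have n0 : 0 < Re w ^+ 2 + Im w ^+ 2 by lra.
  have l1 : ln (1 / 4) <= ln (Re w ^+ 2 + Im w ^+ 2) by rewrite ler_ln ?posrE//; lra.
  have l2 : ln (Re w ^+ 2 + Im w ^+ 2) <= ln M by rewrite ler_ln ?posrE//; lra.
  move: (ln (Re w ^+ 2 + _)) l1 l2 => L l1 l2.
  have L0 : `|2^-1 * L| <= `|ln (1 / 4)| + `|ln M|.
    have := ler_norm (ln M); have := ler_norm (- ln (1 / 4 : R)); rewrite normrN.
    have := normr_ge0 (ln M); have := normr_ge0 (ln (1 / 4 : R)).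
    by rewrite ler_norml => ? ? ? ?; apply/andP; split; lra.
  have t0 : `|atan (Im w / Re w)| <= pi.
    have := atan_gtNpi2 (Im w / Re w); have := atan_ltpi2 (Im w / Re w).
    by have := pi_gt0 R; rewrite ler_norml => ? ? ?; apply/andP; split; lra.
  apply: le_trans (ler_norm _) _; apply: le_trans (ler_normB _ _) _.
  by rewrite [ `|Re a * _|]normrM [ `|Im a * _|]normrM; apply: lerD; apply: ler_wpM2l.
- exists delta^-1 => z zd; have h := elem_inv_far md zd.
  by rewrite normcV lef_pV2 ?posrE//; apply: lt_le_trans h.
- exists (B + B') => z zd; apply: le_trans (normcD _ _) _.
  by apply: lerD; [exact: hB|exact: hB'].
- exists (B * B') => z zd; rewrite normcM.
  by apply: ler_pM; rewrite ?normc_ge0//; [exact: hB|exact: hB'].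
Qed.

Lemma cder_continuous (c : R -> R[i]) t d : cder c t d ->
  {for t, continuous (fun s => Re (c s))} /\ {for t, continuous (fun s => Im (c s))}.
Proof.
by move=> /cder_derivable[/derivable1_diffP /differentiable_continuous cr
  /derivable1_diffP /differentiable_continuous ci].
Qed.

Definition cdiff (c : R -> R[i]) : Prop := forall t, exists d, cder c t d.

Lemma cdiff_integrable (c : R -> R[i]) (a b : R) : cdiff c ->
  lebesgue_measure.-integrable `[a, b] (EFin \o (fun s => Re (c s))) /\
  lebesgue_measure.-integrable `[a, b] (EFin \o (fun s => Im (c s))).
Proof.
move=> hc; split; apply: continuous_compact_integrable;
  try exact: segment_compact; apply: continuous_subspaceT => t;
  have [d /cder_continuous[cr ci]] := hc t; [exact: cr|exact: ci].
Qed.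

Lemma Rintegral_derive (F F' : R -> R) (a b : R) : a < b ->
  (forall t : R, is_derive t 1 F (F' t)) -> (forall t, {for t, continuous F'}) ->
  (\int[lebesgue_measure]_(t in `[a, b]) F' t)%R = F b - F a.
Proof.
move=> ab dF cF'.
have cF t : {for t, continuous F}.
  by have [/derivable1_diffP /differentiable_continuous] := dF t.
rewrite /Rintegral (@continuous_FTC2 _ F' F)//.
- by apply: continuous_subspaceT => t; exact: cF'.
- split; first by move=> t _; case: (dF t).
    exact/cvg_at_right_filter/cF.
  exact/cvg_at_left_filter/cF.
- by move=> t _; rewrite derive1E; case: (dF t).
Qed.

Lemma cintegral_derive (F F' : R -> R[i]) (a b : R) : a < b ->
  (forall t, cder F t (F' t)) -> cdiff F' -> cintegral a b F' = F b - F a.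
Proof.
move=> ab dF dF'; apply: complex_ext; rewrite !cE /=.
  apply: (@Rintegral_derive (fun t => Re (F t)) (fun t => Re (F' t))) => // t.
    by case: (dF t).
  by have [d /cder_continuous[]] := dF' t.
apply: (@Rintegral_derive (fun t => Im (F t)) (fun t => Im (F' t))) => // t.
  by case: (dF t).
by have [d /cder_continuous[]] := dF' t.
Qed.

Lemma cdiff_cst c : cdiff (fun=> c).
Proof. by move=> t; exists 0; exact: cder_cst. Qed.

Lemma cdiffD (c c' : R -> R[i]) : cdiff c -> cdiff c' -> cdiff (fun t => c t + c' t).
Proof.
move=> h h' t; have [d hd] := h t; have [d' hd'] := h' t.
by exists (d + d'); exact: cderD.
Qed.

Lemma cdiffM (c c' : R -> R[i]) : cdiff c -> cdiff c' -> cdiff (fun t => c t * c' t).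
Proof.
move=> h h' t; have [d hd] := h t; have [d' hd'] := h' t.
by exists (d * c' t + c t * d'); exact: cderM.
Qed.

Lemma cintegralD (c c' : R -> R[i]) (a b : R) : cdiff c -> cdiff c' ->
  cintegral a b (fun t => c t + c' t) = cintegral a b c + cintegral a b c'.
Proof.
move=> /cdiff_integrable-/(_ a b)[cr ci] /cdiff_integrable-/(_ a b)[cr' ci'].
apply: complex_ext; rewrite !cE /=.
  by under eq_Rintegral do rewrite cReD; rewrite RintegralD.
by under eq_Rintegral do rewrite cImD; rewrite RintegralD.
Qed.

Lemma cintegralZ k (c : R -> R[i]) (a b : R) : cdiff c ->
  cintegral a b (fun t => k * c t) = k * cintegral a b c.
Proof.
move=> /cdiff_integrable-/(_ a b)[cr ci].
apply: complex_ext; rewrite !cE /=.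
  under eq_Rintegral do rewrite cReM.
  by rewrite RintegralB ?RintegralZl//; [exact: (integrableZl _ _ cr)|exact: (integrableZl _ _ ci)].
under eq_Rintegral do rewrite cImM.
by rewrite RintegralD ?RintegralZl//; [exact: (integrableZl _ _ ci)|exact: (integrableZl _ _ cr)].
Qed.

Lemma cintegral_eq (c c' : R -> R[i]) (a b : R) : c =1 c' ->
  cintegral a b c = cintegral a b c'.
Proof. by move=> /funext ->. Qed.

Lemma cintegral_sum (I : Type) (r : seq I) (c : I -> R -> R[i]) (a b : R) :
  (forall i, cdiff (c i)) ->
  cintegral a b (fun t => \sum_(i <- r) c i t) = \sum_(i <- r) cintegral a b (c i).
Proof.
move=> hc; elim: r => [|i r IH].
  rewrite big_nil (@cintegral_eq _ (fun t => 0 * (fun=> 0) t)).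
    by rewrite cintegralZ ?mul0r//; exact: cdiff_cst.
  by move=> t; rewrite big_nil mul0r.
rewrite big_cons -IH -cintegralD//; last first.
  by move=> t; elim: r {IH} => [|j r [d hd]];
    [exists 0; under eq_fun do rewrite big_nil; exact: cder_cst|
     have [d' hd'] := hc j t; exists (d' + d); under eq_fun do rewrite big_cons; exact: cderD].
by apply: cintegral_eq => t; rewrite big_cons.
Qed.

Definition circ rho (t : R) : R[i] := nu + rho%:C * cexp (t *i).

Lemma cder_expi t : cder (fun s : R => cexp (s *i)) t ('i * cexp (t *i)).
Proof.
apply: (cder_eq (cder_exp (cder_im (is_derive_id t 1)))).
by congr (_ * _).
Qed.

Lemma cder_circ rho t : cder (circ rho) t (rho%:C * 'i * cexp (t *i)).
Proof.
apply: (cder_eq (cderD (cder_cst nu t) (cderMc rho%:C (cder_expi t)))).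
by rewrite add0r mulrA.
Qed.

Lemma cder_circ_radius rho t : cder (circ ^~ t) rho (cexp (t *i)).
Proof.
apply: (cder_eq (cderD (cder_cst nu rho)
  (cderM (cder_real (is_derive_id rho 1)) (cder_cst _ rho)))).
by rewrite add0r mulr0 addr0 mul1r.
Qed.

Lemma circ_disc rho t : normc (circ rho t - nu) = `|rho|.
Proof.
rewrite /circ addrC addKr normcM normc_cexp /= expR0 mulr1 expr0n addr0.
by rewrite sqrtr_sqr.
Qed.

Lemma circ2pi rho : circ rho (2 * pi) = circ rho 0.
Proof.
rewrite /circ; congr (_ + _ * _); rewrite /cexp /=.
by rewrite mulr_natl -[pi *+ 2]add0r cosD2pi sinD2pi.
Qed.

Lemma elem_cdiff_circ g rho : elementary g -> `|rho| < delta ->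
  cdiff (fun t => g (circ rho t)).
Proof.
move=> eg r t; have [g' eg' hg] := elem_holo eg.
exists (g' (circ rho t) * (rho%:C * 'i * cexp (t *i))).
by apply: (hg (circ rho t)); rewrite ?circ_disc//; exact: cder_circ.
Qed.

Lemma cdiff_circ_factor rho : cdiff (fun t => rho%:C * 'i * cexp (t *i)).
Proof.
by apply: cdiffM; [exact: cdiff_cst|move=> t; eexists; exact: cder_expi].
Qed.

(** Up to the factor [i rho], differentiating [g (nu + rho e^(it))] in [rho] gives its
    derivative in [t], whose integral over a period vanishes.  So the circle averages do
    not depend on the radius. *)
Lemma mean_value_Re g rho : elementary g -> 0 < rho < delta ->
  (\int[lebesgue_measure]_(t in `[0%R, 2 * pi]) Re (g (circ rho t)))%R
  = 2 * pi * Re (g nu).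
Proof.
move=> eg /andP[r0 rd]; have [g' eg' hg] := elem_holo eg.
have p2 : 0 < 2 * pi :> R by rewrite mulr_gt0// pi_gt0.
pose mu := @lebesgue_measure R.
pose F x := (\int[mu]_(t in `[0%R, 2 * pi]) Re (g (circ x t)))%R.
pose fp (x t : R) := Re (g (circ x t)).
have xd x : `](- delta), delta[%classic x -> `|x| < delta.
  by rewrite /= in_itv/= ltr_norml.
have dfp x t : `](- delta), delta[%classic x ->
    is_derive x 1 (fp ^~ t) (Re (g' (circ x t) * cexp (t *i))).
  move=> /xd h; have [] // := hg (circ x t) _ (circ ^~ t) x (cexp (t *i)) erefl (cder_circ_radius x t).
  by rewrite circ_disc.
have [B hB] := elem_bounded eg'.
have B0 : 0 <= B.
  by apply: le_trans (normc_ge0 _) (hB nu _); rewrite subrr normc0.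
have intf x : `](- delta), delta[%classic x ->
    mu.-integrable `[0%R, 2 * pi] (EFin \o fp x).
  by move=> /xd h; have [] := cdiff_integrable 0 (2 * pi) (elem_cdiff_circ eg h).
have derf x t : `](- delta), delta[%classic x -> `[0%R, 2 * pi]%classic t ->
    derivable (fp ^~ t) x 1.
  by move=> h _; case: (dfp x t h).
have intG : mu.-integrable `[0%R, 2 * pi] (EFin \o (fun _ : R => B)).
  apply: continuous_compact_integrable; first exact: segment_compact.
  by apply: continuous_subspaceT => t; exact: cst_continuous.
have Gub x t : `](- delta), delta[%classic x -> `[0%R, 2 * pi]%classic t ->
    `|partial1of2 fp x t| <= B.
  move=> h _; rewrite partial1of2E; have [_ ->] := dfp x t h.
  have := Re_ge_normc (g' (circ x t) * cexp (t *i)).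
  rewrite normcM normc_cexp expR0 mulr1 -ler_norml => h1; apply: le_trans h1 _.
  by apply: hB; rewrite circ_disc xd.
have dF x : `](- delta), delta[%classic x -> x != 0 -> is_derive x 1 F 0.
  move=> h x0; split.
    exact: (@derivable_under_integral _ _ _ mu fp _ _ x _ _ h intf derf _ _ intG Gub).
  rewrite -derive1E (@differentiation_under_integral _ _ _ mu fp _ _ x _ _ h intf derf _ _ intG Gub)//.
  have e t : partial1of2 fp x t = Re (g' (circ x t) * cexp (t *i)).
    by rewrite partial1of2E; case: (dfp x t h).
  under eq_Rintegral do rewrite e.
  have dIm (t : R) : is_derive t 1 (fun s => x^-1 * Im (g (circ x s)))
      (Re (g' (circ x t) * cexp (t *i))).
    have cd : normc (circ x t - nu) < delta by rewrite circ_disc xd.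
    have := cderMc (x^-1)%:C (hg _ cd (circ x) t _ erefl (cder_circ x t)).
    case=> _; rewrite !cE /=.
    have -> : (fun s => Im ((x^-1)%:C * g (circ x s))) = (fun s => x^-1 * Im (g (circ x s))).
      by apply/funext => s; rewrite cE /= mul0r addr0.
    move=> hd; apply: (is_derive_eq hd).
    by move: (g' _) => [p q] /=; field.
  rewrite (Rintegral_derive p2 dIm) ?circ2pi ?subrr// => t.
  have : cdiff (fun t => g' (circ x t) * cexp (t *i)).
    apply: cdiffM; first exact: elem_cdiff_circ (xd _ h).
    by move=> s; eexists; exact: cder_expi.
  by move=> /(_ t)[d /cder_continuous[]].
have cF x : `](- delta), delta[%classic x -> {for x, continuous F}.
  move=> h; apply/differentiable_continuous/derivable1_diffP.
  exact: (@derivable_under_integral _ _ _ mu fp _ _ x _ _ h intf derf _ _ intG Gub).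
have in1 x : x \in `]0, rho[%R -> is_derive x 1 F 0.
  rewrite in_itv/= => /andP[x0 xr].
  by apply: dF; rewrite ?gt_eqF//= in_itv/=; apply/andP; split; lra.
have cF1 : {within `[0, rho], continuous F}.
  apply: continuous_in_subspaceT => x; rewrite inE/= in_itv/= => /andP[x0 xr].
  by apply: cF; rewrite /= in_itv/=; apply/andP; split; lra.
have [x _ /eqP] := MVT r0 in1 cF1.
rewrite mul0r subr_eq0 => /eqP; rewrite -/(F rho) => ->.
have circ0 t : circ 0 t = nu by rewrite /circ mul0r addr0.
have dl (t : R) : is_derive t 1 (fun s : R => Re (g nu) * s) (Re (g (circ 0 t))).
  apply: (is_derive_eq (is_deriveM (is_derive_cst (Re (g nu)) t 1) (is_derive_id t 1))).
  by rewrite circ0 /GRing.scale/= mulr0 addr0 mulr1.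
rewrite /F (Rintegral_derive p2 dl); first by rewrite mulr0 subr0 mulrC.
move=> t; rewrite (_ : (fun t0 => Re _) = cst (Re (g nu))).
  exact: cst_continuous.
by apply/funext => s; rewrite circ0.
Qed.

(** The imaginary part of [g] is the real part of [- i g]. *)
Lemma mean_value g rho : elementary g -> 0 < rho < delta ->
  cintegral 0 (2 * pi) (fun t => g (circ rho t)) = (2 * pi)%:C * g nu.
Proof.
move=> eg r; apply: complex_ext; rewrite !cE /= ?mul0r ?subr0 ?addr0.
  exact: mean_value_Re.
have eg' : elementary (fun z => (- 'i) * g z) by apply: elem_mul eg; exact: elem_cst.
have := mean_value_Re eg' r; rewrite !cE /= => h.
rewrite (_ : Im (g nu) = - 0 * Re (g nu) - -1 * Im (g nu)); last by ring.
rewrite -h; apply: eq_Rintegral => t _.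
by rewrite !cE /=; ring.
Qed.

Lemma elem_inv_exp m k : 2 * delta <= normc (m - nu) ->
  elementary (fun z => (z - m)^-1 ^+ k).
Proof.
move=> hm; elim: k => [|k IH].
  by rewrite (_ : (fun _ => _) = fun=> 1); [exact: elem_cst|apply/funext].
rewrite (_ : (fun _ => _) = fun z => (z - m)^-1 * (z - m)^-1 ^+ k).
  by apply: elem_mul IH; exact: elem_inv.
by apply/funext => z; rewrite exprS.
Qed.

Variable rho : R.
Hypothesis rhod : 0 < rho < delta.

Lemma rho_lt : `|rho| < delta.
Proof. by case/andP: rhod => r0 rd; rewrite gtr0_norm. Qed.

Lemma rhoC_neq0 : rho%:C != 0 :> R[i].
Proof. by case/andP: rhod => r0 rd; rewrite eq_complex /= gt_eqF. Qed.

Lemma circB_neq0 t : circ rho t - nu != 0.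
Proof. by rewrite /circ addrC addKr mulf_neq0 ?rhoC_neq0 ?cexp_neq0. Qed.

(** The contour integral is the circle average of [i (z - nu) h z], which vanishes at the
    centre. *)
Lemma circle_integral_holo h : elementary h -> circle_integral nu rho h = 0.
Proof.
move=> eh.
have eg : elementary (fun z => h z * ('i * (z + - nu))).
  apply: elem_mul => //; apply: elem_mul; first exact: elem_cst.
  by apply: elem_add; [exact: elem_id|exact: elem_cst].
have := mean_value eg rhod; rewrite subrr !mulr0 => <-.
apply: cintegral_eq => t; rewrite -/(circ rho t); congr (_ * _).
by rewrite /circ; ring.
Qed.

Lemma circle_integral_pow1 a :
  circle_integral nu rho (fun z => f a z * (z - nu)^-1)
  = 2 * (pi : R)%:C * 'i * f a nu.
Proof.
have eg : elementary (fun z => 'i * f a z).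
  by apply: elem_mul; [exact: elem_cst|exact: elem_pow].
have := mean_value eg rhod; rewrite rmorphM /= => h.
transitivity ((2 : R)%:C * pi%:C * ('i * f a nu)); last first.
  by rewrite (_ : (2 : R)%:C = 2) ?rmorph_nat// mulrA.
rewrite -h; apply: cintegral_eq => t; rewrite -/(circ rho t).
have := circB_neq0 t; rewrite /circ [nu + _ - _]addrC addKr => h0.
have e0 := cexp_neq0 (t *i); have r0 := rhoC_neq0.
by field; rewrite e0 r0.
Qed.

Lemma cdiff_circ_inv k : cdiff (fun t => (circ rho t - nu)^-1 ^+ k).
Proof.
move=> t.
have h := cderX k (cderV (cderD (cder_circ rho t) (cder_cst (- nu) t)) (circB_neq0 t)).
by eexists; exact: h.
Qed.

Lemma cdiff_circle_pow a k : cdiff (fun t => f a (circ rho t) *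
  (circ rho t - nu)^-1 ^+ k * (rho%:C * 'i * cexp (t *i))).
Proof.
apply: cdiffM; last exact: cdiff_circ_factor.
apply: cdiffM; last exact: cdiff_circ_inv.
by apply: elem_cdiff_circ rho_lt; exact: elem_pow.
Qed.

(** Integration by parts along the circle. *)
Lemma circle_integral_powS a k :
  circle_integral nu rho (fun z => f a z * (z - nu)^-1 ^+ k.+2)
  = a / k.+1%:R * circle_integral nu rho (fun z => f (a - 1) z * (z - nu)^-1 ^+ k.+1).
Proof.
have k0 : k.+1%:R != 0 :> R[i] by rewrite pnatr_eq0.
pose F t := f a (circ rho t) * (circ rho t - nu)^-1 ^+ k.+1.
pose J b n t := f b (circ rho t) * (circ rho t - nu)^-1 ^+ n * (rho%:C * 'i * cexp (t *i)).
pose F' t := a * J (a - 1) k.+1 t + (- k.+1%:R) * J a k.+2 t.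
have dF t : cder F t (F' t).
  have d1 : cder (fun t => f a (circ rho t)) t
      (a * f (a - 1) (circ rho t) * (rho%:C * 'i * cexp (t *i))).
    apply: (@holo_pow a (circ rho t) _ (circ rho) t) => //; last exact: cder_circ.
    by rewrite circ_disc rho_lt.
  have d2 := cderX k.+1 (cderV (cderD (cder_circ rho t) (cder_cst (- nu) t)) (circB_neq0 t)).
  apply: (cder_eq (cderM d1 d2)); rewrite /F' /J /=.
  have := circB_neq0 t; set w := circ rho t - nu => w0.
  rewrite !exprVn !exprS; move: (w ^+ k) (expf_neq0 k w0) => wk wk0.
  by field; rewrite w0 wk0.
have dF' : cdiff F'.
  apply: cdiffD; apply: cdiffM; try exact: cdiff_cst; exact: cdiff_circle_pow.
have p2 : 0 < 2 * pi :> R by rewrite mulr_gt0// pi_gt0.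
have := cintegral_derive p2 dF dF'.
rewrite /F circ2pi subrr /F' cintegralD; last 2 first.
- by apply: cdiffM; [exact: cdiff_cst|exact: cdiff_circle_pow].
- by apply: cdiffM; [exact: cdiff_cst|exact: cdiff_circle_pow].
rewrite !cintegralZ; try exact: cdiff_circle_pow.
rewrite -[cintegral _ _ (J a _)]/(circle_integral nu rho (fun z => f a z * (z - nu)^-1 ^+ k.+2)).
rewrite -[cintegral _ _ (J (a - 1) _)]/(circle_integral nu rho (fun z => f (a - 1) z * (z - nu)^-1 ^+ k.+1)).
move: (circle_integral _ _ _) (circle_integral _ _ _) => p q h.
apply: (mulfI k0); apply/eqP; rewrite -subr_eq0 -[X in _ == X]oppr0 -h; apply/eqP.
by field.
Qed.

(** This is Cauchy's formula for the Taylor coefficients of the powers. *)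
Lemma circle_integral_pow a k :
  circle_integral nu rho (fun z => f a z * (z - nu)^-1 ^+ k.+1)
  = 2 * (pi : R)%:C * 'i * (cbin a k * f (a - k%:R) nu).
Proof.
elim: k a => [|k IH] a.
  rewrite /= subr0 mul1r -circle_integral_pow1.
  by apply: cintegral_eq => t; rewrite expr1.
have -> : a - k.+1%:R = a - 1 - k%:R by rewrite -natr1; ring.
by rewrite circle_integral_powS IH /=; ring.
Qed.
End Discs.

(** * The functional calculus of powers *)

Section Dunford.
Variable R : realType.
Implicit Types (z nu m a : R[i]) (delta rho : R).

Lemma finite_radius (s : seq R[i]) (P : R[i] -> R -> Prop) :
  (forall nu d d', P nu d -> 0 < d' <= d -> P nu d') ->
  (forall nu, nu \in s -> exists2 d : R, 0 < d & P nu d) ->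
  exists2 d : R, 0 < d & forall nu, nu \in s -> P nu d.
Proof.
move=> mono; elim: s => [|nu s IH] h; first by exists 1.
have [d d0 hd] := h nu (mem_head _ _).
have [|d' d'0 hd'] := IH; first by move=> m ms; apply: h; rewrite inE ms orbT.
exists (Num.min d d'); first by rewrite lt_min d0.
move=> m; rewrite inE => /predU1P[->|/hd' hm].
  by apply: mono hd _; rewrite lt_min d0 d'0 ge_min lexx.
by apply: mono hm _; rewrite lt_min d0 d'0 ge_min lexx orbT.
Qed.

Variables (l : nat) (X : 'M[R[i]]_l).

Lemma eigenvalue_seq : exists2 s : seq R[i], uniq s & forall z, eigenvalue X z = (z \in s).
Proof.
have [s hs] := closed_field_poly_normal (char_poly X).
exists (undup s); first exact: undup_uniq.
move=> z; rewrite mem_undup eigenvalue_root_char hs rootZ ?root_prod_XsubC//.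
by rewrite (monicP (char_poly_monic X)) oner_neq0.
Qed.

Variable f : R[i] -> R[i] -> R[i].
Hypothesis f_local : forall nu, eigenvalue X nu -> local_power f nu.

(** Each partial fraction of the resolvent contributes only through the circle around its
    own pole, where [circle_integral_pow] applies; on the other circles it is holomorphic. *)
Lemma hfc_power (I : eqType) (r : seq I) (m : I -> R[i]) (k : I -> nat)
    (N : I -> 'M[R[i]]_l) a :
  (forall i, i \in r -> eigenvalue X (m i)) ->
  (forall z, ~~ eigenvalue X z ->
    invmx (z%:M - X) = \sum_(i <- r) (z - m i)^-1 ^+ (k i).+1 *: N i) ->
  hfc (f a) X = \sum_(i <- r) (cbin a (k i) * f (a - (k i)%:R) (m i)) *: N i.
Proof.
move=> hm hres; have [s us hs] := eigenvalue_seq.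
have [d d0 hd] : exists2 d : R, 0 < d & forall nu, nu \in s ->
    (forall z, normc (z - nu) < d -> 1 / 2 <= Re (z / nu) /\
       forall a, f a z = f a nu * cexp (a * Log (z / nu))) /\
    (forall mu, mu \in s -> mu != nu -> 2 * d <= normc (mu - nu)).
  apply: finite_radius.
    move=> nu e e' [h1 h2] /andP[e0 ee]; split.
      by move=> z ze; apply: h1; apply: lt_le_trans ee.
    by move=> mu ms mn; apply: le_trans (h2 _ ms mn); rewrite ler_pM2l.
  move=> nu nus.
  have [|_ _ [e e0 he]] := @f_local nu; first by rewrite hs.
  have [e' e'0 he'] : exists2 e' : R, 0 < e' & forall mu, mu \in s ->
      (mu != nu -> 2 * e' <= normc (mu - nu)).
    apply: (@finite_radius s (fun mu e' => mu != nu -> 2 * e' <= normc (mu - nu))).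
      by move=> mu e1 e2 h /andP[? h'] hn; apply: le_trans (h hn); rewrite ler_pM2l.
    move=> mu ms; have [->|mn] := eqVneq mu nu; first by exists 1.
    exists (normc (mu - nu) / 2); first by rewrite divr_gt0 ?normc_gt0 ?subr_eq0.
    by move=> _; rewrite mulrC divfK.
  exists (Num.min e e'); first by rewrite lt_min e0.
  split.
    by move=> z; rewrite lt_min => /andP[? _]; exact: he.
  by move=> mu ms mn; apply: le_trans (he' _ ms mn); rewrite ler_pM2l// ge_min lexx orbT.
pose M := \sum_(i <- r) (cbin a (k i) * f (a - (k i)%:R) (m i)) *: N i.
have key rho : 0 < rho < d -> dunford rho (f a) X = M.
  move=> rhod; apply/matrixP => p q; rewrite /dunford mxE.
  have -> : [set mu | eigenvalue X mu] = [set` s].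
    by apply/seteqP; split => z /=; rewrite hs.
  rewrite -fsbig_seq//.
  have circE nu : nu \in s ->
      circle_integral nu rho (fun z => f a z * invmx (z%:M - X) p q)
      = \sum_(i <- r) N i p q * (2 * (pi : R)%:C * 'i *
          (if m i == nu then cbin a (k i) * f (a - (k i)%:R) (m i) else 0)).
    move=> nus; have [hd1 hd2] := hd nu nus.
    have [|nu0 fS _] := @f_local nu; first by rewrite hs.
    transitivity (cintegral 0 (2 * pi) (fun t => \sum_(i <- r) N i p q *
       (if m i \in s then f a (circ nu rho t) * (circ nu rho t - m i)^-1 ^+ (k i).+1 *
         (rho%:C * 'i * cexp (t *i)) else 0))).
      apply: cintegral_eq => t; rewrite -/(circ nu rho t).
      have nz : ~~ eigenvalue X (circ nu rho t).
        rewrite hs; apply/negP => zs.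
        have rn := circ_disc nu rho t; case/andP: rhod => r0 rd.
        have [zn|zn] := eqVneq (circ nu rho t) nu.
          by move: rn; rewrite zn subrr normc0 => /esym/eqP; rewrite normr_eq0 gt_eqF.
        by have := hd2 _ zs zn; rewrite rn gtr0_norm//; lra.
      rewrite hres// summxE big_distrr big_distrl /=; apply: eq_big_seq => i ir.
      by rewrite -hs hm// mxE; ring.
    rewrite cintegral_sum; last first.
      move=> i; apply: cdiffM; first exact: cdiff_cst.
      case: (boolP (m i \in s)) => ms; last exact: cdiff_cst.
      have [->|mn] := eqVneq (m i) nu.
        exact: (cdiff_circle_pow nu0 fS d0 hd1 rhod).
      apply: cdiffM; last exact: cdiff_circ_factor.
      apply: (@elem_cdiff_circ _ f nu d nu0 fS d0 hd1 (fun z => f a z * (z - m i)^-1 ^+ (k i).+1)).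
        apply: elem_mul; first exact: elem_pow.
        by apply: elem_inv_exp; exact: hd2.
      exact: rho_lt rhod.
    apply: eq_big_seq => i ir; have ms : m i \in s by rewrite -hs hm.
    rewrite ms.
    have [mn|mn] := eqVneq (m i) nu.
      rewrite mn cintegralZ; last exact: (cdiff_circle_pow nu0 fS d0 hd1 rhod).
      by congr (_ * _); exact: (circle_integral_pow nu0 fS d0 hd1 rhod).
    have el : elementary f nu d (fun z => f a z * (z - m i)^-1 ^+ (k i).+1).
      apply: elem_mul; first exact: elem_pow.
      by apply: elem_inv_exp; exact: hd2.
    rewrite cintegralZ.
      rewrite mulr0; congr (_ * _).
      exact: (circle_integral_holo nu0 fS d0 hd1 rhod el).
    apply: cdiffM; last exact: cdiff_circ_factor.
    by apply: (elem_cdiff_circ nu0 fS d0 hd1 el); exact: rho_lt rhod.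
  rewrite (eq_big_seq _ circE) exchange_big /= summxE mulr_sumr.
  apply: eq_big_seq => i ir; have ms : m i \in s by rewrite -hs hm.
  rewrite -mulr_sumr -mulr_sumr mxE (bigD1_seq (m i)) ?eqxx//=.
  rewrite big1 ?addr0; last by move=> z /negbTE; rewrite eq_sym => ->.
  have p0 : (pi : R)%:C != 0 :> R[i].
    by rewrite eq_complex /= gt_eqF// pi_gt0.
  have i0 : ('i : R[i]) != 0 by rewrite eq_complex /= oner_eq0 andbF.
  have c0 : 2 * (pi : R)%:C * 'i != 0 :> R[i] by rewrite !mulf_neq0// pnatr_eq0.
  by rewrite mulrCA mulKf// mulrC.
have nearM : \forall rho \near (0 : R)^'+, dunford rho (f a) X = M.
  near=> rho; apply: key; apply/andP; split; first by near: rho; exact: nbhs_right_gt.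
  by near: rho; exact: nbhs_right_lt.
rewrite /hfc; case: xgetP => [M' _ /= hM'|]; last by move=> /(_ M).
have [rho [h1 h2]] : exists rho, dunford rho (f a) X = M /\ dunford rho (f a) X = M'.
  exact: (@filter_ex _ _ (at_right_proper_filter 0) _ (filterI nearM hM')).
by rewrite -h2 h1.
Unshelve. all: by end_near. Qed.

(** All matrices in the definition of the functional calculus are symmetric when
    the argument is. *)
Lemma trmx_hfc (g : R[i] -> R[i]) : X^T = X -> (hfc g X)^T = hfc g X.
Proof.
move=> XT; rewrite /hfc; case: xgetP => [M _ /= hM|_]; last by rewrite trmx0.
have [rho <-] : exists rho, dunford rho g X = M by exact: (@filter_ex _ _ (at_right_proper_filter 0) _ hM).
apply/matrixP => p q; rewrite !mxE; congr (_ * _); apply: eq_fsbigr => mu _.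
apply: cintegral_eq => t; congr (_ * _ * _).
by rewrite -[in RHS](trmxK (invmx _)) trmx_inv linearB /= tr_scalar_mx XT mxE.
Qed.

End Dunford.

(** * A logarithm along the scalar pencil *)

Section ScalarPencil.
Variable R : realType.
Implicit Types (mu : R[i]) (t : R).

(** The value of [x1 + mu x2] at the point of the unit circle with angle [t], and its
    derivative. *)
Definition pen mu t : R[i] := (cos t)%:C + mu * (sin t)%:C.
Definition dpen mu t : R[i] := - (sin t)%:C + mu * (cos t)%:C.

Lemma cder_cosC t : cder (fun s : R => (cos s)%:C) t (- (sin t)%:C).
Proof. by apply: (cder_eq (cder_real (is_derive_cos t))); rewrite rmorphN. Qed.

Lemma cder_sinC t : cder (fun s : R => (sin s)%:C) t (cos t)%:C.
Proof. exact: (cder_real (is_derive_sin t)). Qed.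

Lemma cder_pen mu t : cder (pen mu) t (dpen mu t).
Proof. exact: (cderD (cder_cosC t) (cderMc mu (cder_sinC t))). Qed.

(** [pen mu t * cexp (- (t *i))] equals [A + B exp (- 2 i t)] with [2 A = 1 - i mu] and
    [2 B = 1 + i mu].  For [Im mu > 0] this circle does not enclose the origin, as
    [|B| < |A|]; the constant factor, the conjugate of [2 A], makes its centre positive and
    so moves it into the right half-plane, where [Log] is available for all [t]. *)
Definition rotated_pen mu t : R[i] :=
  (1 + Im mu +i* Re mu) * pen mu t * cexp (- (t *i)).

Lemma Re_rotated_pen_gt0 mu t : 0 < Im mu -> 0 < Re (rotated_pen mu t).
Proof.
case: mu => a b /= b0; rewrite /rotated_pen oppr0 expR0 cosN sinN.
have c2 := cos2Dsin2 t; move: (cos t) (sin t) c2 => c s c2.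
(* a positive definite form in [c] and [s] *)
rewrite [X in 0 < X](_ : _ = (a * s + c) ^+ 2 + b * c ^+ 2 + (b + b ^+ 2) * s ^+ 2); last by ring.
have b2 := sqr_ge0 b; have h := sqr_ge0 (a * s + c).
have h1 : 0 <= b ^+ 2 * s ^+ 2 by rewrite mulr_ge0 ?sqr_ge0.
rewrite mulrDl; have -> : (a * s + c) ^+ 2 + b * c ^+ 2 + (b * s ^+ 2 + b ^+ 2 * s ^+ 2)
  = (a * s + c) ^+ 2 + b ^+ 2 * s ^+ 2 + b * (c ^+ 2 + s ^+ 2) by ring.
by rewrite c2 mulr1; lra.
Qed.

(** A logarithm of [pen mu] along the whole line. *)
Definition plog mu t : R[i] := t *i + (Log (rotated_pen mu t) - Log (rotated_pen mu 0)).

Lemma plog0 mu : plog mu 0 = 0.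
Proof. by rewrite /plog subrr addr0. Qed.

Section PositiveImaginaryPart.
Variable mu : R[i].
Hypothesis mu0 : 0 < Im mu.

Lemma cexp_plog t : cexp (plog mu t) = pen mu t.
Proof.
rewrite /plog !cexpD cexpN !cexp_Log ?Re_rotated_pen_gt0//.
have c0 : 1 + Im mu +i* Re mu != 0.
  by rewrite eq_complex /= negb_and gt_eqF// ltr_wpDl.
have e0 := cexp_neq0 (t *i).
have -> : rotated_pen mu 0 = 1 + Im mu +i* Re mu.
  rewrite /rotated_pen /pen cos0 sin0 mulr0 addr0 mulr1.
  by rewrite (_ : - (0 *i) = 0) ?cexp0 ?mulr1// ; apply: complex_ext; rewrite /= oppr0.
rewrite /rotated_pen cexpN; field.
by rewrite e0 c0.
Qed.

Lemma pen_neq0 t : pen mu t != 0.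
Proof. by rewrite -cexp_plog cexp_neq0. Qed.

Lemma cder_plog t : cder (plog mu) t (dpen mu t / pen mu t).
Proof.
have p0 := pen_neq0 t; have e0 := cexp_neq0 (- (t *i)).
have d1 : cder (fun s : R => s *i) t ('i) by exact: (cder_im (is_derive_id t 1)).
have c0 : 1 + Im mu +i* Re mu != 0.
  by rewrite eq_complex /= negb_and gt_eqF// ltr_wpDl.
have d2 := cderM (cderMc (1 + Im mu +i* Re mu) (cder_pen mu t)) (cder_exp (cderN d1)).
have d3 := cder_Log d2 (Re_rotated_pen_gt0 t mu0).
apply: (cder_eq (cderD d1 (cderD d3 (cder_cst _ t)))).
by field; rewrite e0 c0 p0.
Qed.

(** The derivative of the argument of [pen mu] is [Im mu / |pen mu|^2]. *)
Lemma Im_plog_increasing (x y : R) : x < y -> Im (plog mu x) < Im (plog mu y).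
Proof.
move=> xy.
have d (t : R) : is_derive t 1 (fun s => Im (plog mu s)) (Im (dpen mu t / pen mu t)).
  by case: (cder_plog t).
have cd : {within `[x, y], continuous (fun s => Im (plog mu s))}.
  by apply: continuous_subspaceT => t; have [] := cder_continuous (cder_plog t).
have [t _ E] := MVT xy (fun t _ => d t) cd.
rewrite -subr_gt0 E mulr_gt0 ?subr_gt0//.
have n0 := sqr_norm_gt0 (pen_neq0 t).
rewrite cImM cReV cImV.
have -> : Re (dpen mu t) * - (Im (pen mu t) / (Re (pen mu t) ^+ 2 + Im (pen mu t) ^+ 2)) +
  Im (dpen mu t) * (Re (pen mu t) / (Re (pen mu t) ^+ 2 + Im (pen mu t) ^+ 2))
  = Im mu * (cos t ^+ 2 + sin t ^+ 2) / (Re (pen mu t) ^+ 2 + Im (pen mu t) ^+ 2).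
  move: (_ ^+ 2 + _ ^+ 2) n0 => n n0.
  by rewrite /pen /dpen !cE /=; field; rewrite gt_eqF.
by rewrite cos2Dsin2 mulr1 divr_gt0.
Qed.

Lemma Im_plog2pi : Im (plog mu (2 * pi)) = 2 * pi.
Proof.
have -> : plog mu (2 * pi) = (2 * pi) *i.
  rewrite /plog (_ : rotated_pen mu (2 * pi) = rotated_pen mu 0) ?subrr ?addr0//.
  rewrite /rotated_pen /pen /cexp /= !cosN !sinN mulr_natl -[pi *+ 2]add0r.
  by rewrite cosD2pi sinD2pi oppr0.
by [].
Qed.

(** The imaginary part of [plog mu] increases from [0] to [2 pi] over a full turn, so it lies
    in the range of the branch [argp]. *)
Lemma logp_pen t : 0 < t < 2 * pi -> logp (pen mu t) = plog mu t /\ 0 < argp (pen mu t).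
Proof.
move=> /andP[t0 t2].
have := Im_plog_increasing t0; rewrite plog0 /= => h1.
have := Im_plog_increasing t2; rewrite Im_plog2pi => h2.
have E : logp (pen mu t) = plog mu t.
  by apply: logp_uniq (cexp_plog t) _; rewrite (ltW h1).
by split=> //; rewrite -[argp _]/(Im (logp (pen mu t))) E.
Qed.

End PositiveImaginaryPart.
End ScalarPencil.

Section BinomialIdentities.
Variable R : realType.
Implicit Types a : R[i].

Lemma cbin_absorb a k : a * cbin (a - 1) k = (a - k%:R) * cbin a k.
Proof.
elim: k a => [|k IH] a /=; first by rewrite subr0.
have k0 : k.+1%:R != 0 :> R[i] by rewrite pnatr_eq0.
rewrite mulrCA; move: (IH (a - 1)).
have -> : a - k.+1%:R = a - 1 - k%:R by rewrite -natr1; ring.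
move=> h; transitivity (a / k.+1%:R * ((a - 1) * cbin (a - 1 - 1) k)); first by ring.
by rewrite h; ring.
Qed.

Lemma cbin_pascal a k : cbin a k.+1 = cbin (a - 1) k.+1 + cbin (a - 1) k.
Proof.
have k0 : k.+1%:R != 0 :> R[i] by rewrite pnatr_eq0.
rewrite /= [in RHS]mulrAC cbin_absorb -[in RHS]natr1.
have k0' : k%:R + 1 != 0 :> R[i] by rewrite natr1.
by rewrite -natr1; field.
Qed.

Lemma cbinS a k : k.+1%:R * cbin a k.+1 = a * cbin (a - 1) k.
Proof.
have k0 : k.+1%:R != 0 :> R[i] by rewrite pnatr_eq0.
by rewrite /= mulrA mulrCA divff// mulr1.
Qed.

End BinomialIdentities.

(** * Spectral projections *)

Section SpectralProjections.
Variable F : closedFieldType.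

(** A Bezout identity for the coprime prime powers, proved by adding one root at a time; the
    error term [q] makes the statement meaningful for the empty list. *)
Lemma partition_of_unity (s : seq F) (n : nat) : uniq s ->
  exists (e : F -> {poly F}) (q : {poly F}),
    \sum_(mu <- s) e mu = 1 + q * \prod_(mu <- s) ('X - mu%:P) ^+ n /\
    forall mu, mu \in s -> \prod_(nu <- s) ('X - nu%:P) ^+ n %| ('X - mu%:P) ^+ n * e mu.
Proof.
elim: s => [|mu s IH] /=.
  by move=> _; exists (fun=> 0), (-1); split=> //; rewrite !big_nil mulr1 subrr.
move=> /andP[mus us]; have [e [q [he hd]]] := IH us.
set W := \prod_(nu <- s) _ in he hd; pose w := ('X - mu%:P) ^+ n.
have cop : coprimep w W.
  rewrite /w /W; apply: coprimep_expl.
  elim: s mus {IH us he hd W e q} => [|nu s IH]; first by rewrite big_nil coprimep1.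
  rewrite inE negb_or big_cons coprimepMr => /andP[mn /IH ->]; rewrite andbT.
  apply: coprimep_expr; rewrite coprimep_XsubC root_XsubC eq_sym//.
have [u [v uv]] : exists u v, u * w + v * W = 1.
  have /Bezout_coprimepP[[u v] /= h] := cop.
  move: h; rewrite -size_poly_eq1 => /size_poly1P[c c0 h].
  exists (c^-1 *: u), (c^-1 *: v).
  by rewrite -!scalerAl -scalerDr h -mul_polyC -polyCM mulVf.
exists (fun nu => if nu == mu then v * W else u * w * e nu), (u * q); split.
  rewrite !big_cons eqxx -/W -/w.
  have -> : \sum_(nu <- s) (if nu == mu then v * W else u * w * e nu)
      = u * w * \sum_(nu <- s) e nu.
    rewrite mulr_sumr; apply: eq_big_seq => nu nus.
    by case: eqP => // E; rewrite E (negbTE mus) in nus *.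
  by rewrite he -[in RHS]uv; ring.
move=> nu; rewrite inE big_cons -/W -/w => /predU1P[->|nus].
  by rewrite eqxx; apply: dvdp_mul => //; apply: dvdp_mull.
rewrite ifF; last by apply/eqP => E; rewrite E (negbTE mus) in nus.
rewrite (_ : _ * (u * w * e nu) = u * (w * (('X - nu%:P) ^+ n * e nu))); last by ring.
by apply: dvdp_mull; apply: dvdp_mul => //; exact: hd.
Qed.

(** The polynomials of [partition_of_unity] evaluated at [V], for the roots of the
    characteristic polynomial: by the Cayley-Hamilton theorem, the error term and the
    products with [(V - mu)^(n+1)] vanish. *)
Lemma spectral_projections (n : nat) (V : 'M[F]_n.+1) :
  exists (s : seq F) (E : F -> 'M[F]_n.+1),
  [/\ forall mu, mu \in s -> eigenvalue V mu, \sum_(mu <- s) E mu = 1,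
      forall mu, mu \in s -> (V - mu%:M) ^+ n.+1 * E mu = 0 &
      forall mu, GRing.comm V (E mu)].
Proof.
have [t ht] := closed_field_poly_normal (char_poly V).
rewrite (monicP (char_poly_monic V)) scale1r in ht.
have st : size t = n.+1.
  by apply: succn_inj; rewrite -(size_char_poly V) ht size_prod_XsubC.
have [e [q [he hd]]] := partition_of_unity n.+1 (undup_uniq t).
set W := \prod_(nu <- _) _ in he hd.
have cW : char_poly V %| W.
  rewrite ht /W -big_undup_iterop_count /=.
  rewrite [X in X %| _](eq_bigr (fun nu => ('X - nu%:P) ^+ count_mem nu t))//.
  elim: (undup t) => [|nu r IH]; first by rewrite !big_nil.
  rewrite !big_cons; apply: dvdp_mul => //.
  by apply: dvdp_exp2l; rewrite -st count_size.
have W0 : horner_mx V W = 0.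
  by have /dvdpP[p ->] := cW; rewrite rmorphM /= Cayley_Hamilton mulr0.
exists (undup t), (fun mu => horner_mx V (e mu)); split.
- by move=> mu; rewrite mem_undup eigenvalue_root_char ht root_prod_XsubC.
- by rewrite -rmorph_sum he rmorphD rmorph1 rmorphM /= W0 mulr0 addr0.
- move=> mu mus; have /dvdpP[p hp] := hd mu mus.
  have -> : V - mu%:M = horner_mx V ('X - mu%:P).
    by rewrite rmorphB /= horner_mx_X horner_mx_C.
  by rewrite -rmorphXn -rmorphM /= hp rmorphM /= W0 mulr0.
- by move=> mu; exact: (@comm_mx_horner _ _ V V (e mu) erefl).
Qed.
End SpectralProjections.

(** * Powers of the matrix pencil and their functional calculus *)

Section ConjugateMatrices.
Variable R : realType.
Implicit Types (p q r : nat) (a : R[i]).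

Lemma conjmatD p q (X Y : 'M[R[i]]_(p, q)) : conjmx (X + Y) = conjmx X + conjmx Y.
Proof. by apply/matrixP => i j; rewrite !mxE conjD. Qed.

Lemma conjmatN p q (X : 'M[R[i]]_(p, q)) : conjmx (- X) = - conjmx X.
Proof. by apply/matrixP => i j; rewrite !mxE rmorphN. Qed.

Lemma conjmatZ p q a (X : 'M[R[i]]_(p, q)) : conjmx (a *: X) = conjc a *: conjmx X.
Proof. by apply/matrixP => i j; rewrite !mxE conjM. Qed.

Lemma conjmatM p q r (X : 'M[R[i]]_(p, q)) (Y : 'M[R[i]]_(q, r)) :
  conjmx (X *m Y) = conjmx X *m conjmx Y.
Proof. exact: map_mxM. Qed.

Lemma conjmat_scalar p a : conjmx (a%:M : 'M[R[i]]_p) = (conjc a)%:M.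
Proof. exact: map_scalar_mx. Qed.

Lemma conjmat_sum p q (I : Type) (s : seq I) (X : I -> 'M[R[i]]_(p, q)) :
  conjmx (\sum_(i <- s) X i) = \sum_(i <- s) conjmx (X i).
Proof. exact: map_mx_sum. Qed.

Lemma conjmatK p q (X : 'M[R[i]]_(p, q)) : conjmx (conjmx X) = X.
Proof. by apply/matrixP => i j; rewrite !mxE conjcK. Qed.

Lemma conjmat_toC p q (X : 'M[R]_(p, q)) : conjmx (toC X) = toC X.
Proof. by apply/matrixP => i j; rewrite !mxE conjc_real. Qed.
End ConjugateMatrices.

Section ConjugateCalculus.
Variables (R : realType) (n : nat).
Implicit Types a z : R[i].

Lemma conj_cbin (a : R[i]) k : conjc (cbin a k) = cbin (conjc a) k.
Proof.
elim: k a => [|k IH] a /=; first by rewrite oppr0.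
by rewrite !rmorphM /= conjc_inv rmorph_nat IH rmorphB rmorph1.
Qed.

Lemma eigenvalue_conjmx (X : 'M[R[i]]_n) z :
  eigenvalue (conjmx X) z = eigenvalue X (conjc z).
Proof. by rewrite -[in LHS](conjcK z) /conjmx eigenvalue_map. Qed.

Variables (X : 'M[R[i]]_n) (I : eqType) (r : seq I) (m : I -> R[i]) (k : I -> nat)
  (N : I -> 'M[R[i]]_n).
Hypothesis X_arg : forall z, eigenvalue X z -> z != 0 /\ 0 < argp z.
Hypothesis m_eigen : forall i, i \in r -> eigenvalue X (m i).
Hypothesis resolvent : forall z, ~~ eigenvalue X z ->
  invmx (z%:M - X) = \sum_(i <- r) (z - m i)^-1 ^+ (k i).+1 *: N i.

Lemma hfc_cpowp_resolvent a : hfc (cpowp a) X =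
  \sum_(i <- r) (cbin a (k i) * cpowp (a - (k i)%:R) (m i)) *: N i.
Proof.
apply: (@hfc_power _ _ _ (@cpowp R)) => // nu /X_arg[? ?].
exact: cpowp_local.
Qed.

(** Conjugating the resolvent expansion and using that [cpowm] is the conjugate of [cpowp]. *)
Lemma hfc_cpowm_conj a : hfc (cpowm a) (conjmx X) = conjmx (hfc (cpowp (conjc a)) X).
Proof.
rewrite hfc_cpowp_resolvent.
rewrite (@hfc_power _ _ _ (@cpowm R) _ _ r (fun i => conjc (m i)) k (fun i => conjmx (N i))).
- rewrite conjmat_sum; apply: eq_bigr => i _.
  rewrite conjmatZ; congr (_ *: _); rewrite conjM conj_cbin cpowm_conj !conjcK.
  by rewrite rmorphB rmorph_nat.
- move=> nu; rewrite eigenvalue_conjmx => /X_arg[]; rewrite conjc_eq0 => ? ?.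
  exact: cpowm_local.
- by move=> i ir; rewrite eigenvalue_conjmx conjcK; exact: m_eigen.
- move=> z; rewrite eigenvalue_conjmx => /resolvent h.
  have -> : z%:M - conjmx X = conjmx ((conjc z)%:M - X).
    by rewrite conjmatD conjmatN conjmat_scalar conjcK.
  rewrite /conjmx -map_invmx -/(conjmx _) h conjmat_sum; apply: eq_bigr => i _.
  by rewrite conjmatZ rmorphXn /= conjc_inv conjD conjcK rmorphN.
Qed.
End ConjugateCalculus.

Section MatrixPencil.
Variable R : realType.
Variable n : nat.
Implicit Types (t : R) (a mu : R[i]).

Definition mder (l m : nat) (M : R -> 'M[R[i]]_(l, m)) t (D : 'M[R[i]]_(l, m)) : Prop :=
  forall i j, cder (fun s => M s i j) t (D i j).

(** The matrix [x1 + x2 V] on the unit circle, and its derivative. *)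
Definition mpen (V : 'M[R[i]]_n) t : 'M[R[i]]_n := (cos t)%:C%:M + (sin t)%:C *: V.
Definition dmpen (V : 'M[R[i]]_n) t : 'M[R[i]]_n := - (sin t)%:C%:M + (cos t)%:C *: V.

(** [Q a t] is the power [(cos t + sin t V)^a], followed continuously from the
    identity at [t = 0]. *)
Record pencil_powers (V : 'M[R[i]]_n) (Q : R[i] -> R -> 'M[R[i]]_n) : Prop := {
  pencil_powers0 : forall a, Q a 0 = 1%:M;
  pencil_powers_der : forall a t, mder (Q a) t (a *: (dmpen V t *m Q (a - 1) t));
  pencil_powersS : forall a t, mpen V t *m Q (a - 1) t = Q a t;
  pencil_powers_comm : forall a t, V *m Q a t = Q a t *m V }.
End MatrixPencil.

Section PencilPowers.
Variables (R : realType) (n : nat) (V : 'M[R[i]]_n.+1).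
Hypothesis hV : forall z, eigenvalue V z -> 0 < Im z.
Variables (s : seq R[i]) (E : R[i] -> 'M[R[i]]_n.+1).
Hypothesis hs : forall mu, mu \in s -> eigenvalue V mu.
Hypothesis sumE : \sum_(mu <- s) E mu = 1.
Hypothesis nilE : forall mu, mu \in s -> (V - mu%:M) ^+ n.+1 * E mu = 0.
Hypothesis commE : forall mu, GRing.comm V (E mu).
Implicit Types (t : R) (a mu : R[i]).

Definition nilpart mu k := (V - mu%:M) ^+ k * E mu.

Lemma comm_nilpart mu k : GRing.comm V (nilpart mu k).
Proof.
apply: commrM => //; apply: commrX; apply: commrB => //.
exact: (@comm_mx_scalar _ _ mu V).
Qed.

Lemma mul_nilpart mu k : V * nilpart mu k = mu *: nilpart mu k + nilpart mu k.+1.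
Proof.
rewrite /nilpart exprS -mulrA mulrBl -[mu%:M * _]/(mu%:M *m _) mul_scalar_mx.
by rewrite [RHS]addrC subrK.
Qed.

Definition qcoef a mu t k : R[i] :=
  cbin a k * cexp ((a - k%:R) * plog mu t) * (sin t)%:C ^+ k.

(** The Taylor expansion of [(pen mu t + sin t (V - mu))^a] around [pen mu t], which is
    finite on the range of [E mu], with [pen mu t] raised to powers through [plog mu]. *)
Definition Qpow a t : 'M[R[i]]_n.+1 :=
  \sum_(mu <- s) \sum_(k < n.+1) qcoef a mu t k *: nilpart mu k.

Lemma Im_gt0 mu : mu \in s -> 0 < Im mu.
Proof. by move=> /hs/hV. Qed.

Lemma cexp_shift a mu t k : mu \in s ->
  cexp ((a - k%:R) * plog mu t) = cexp ((a - 1 - k%:R) * plog mu t) * pen mu t.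
Proof.
move=> mus; rewrite -[in RHS](cexp_plog (Im_gt0 mus)) -cexpD; congr cexp; ring.
Qed.

(** The terms of [V * nilpart mu k] of index [k.+1] are moved to the next summand;
    the last one disappears because [V - mu] is nilpotent there. *)
Lemma sum_nilpart_shift mu (x y : nat -> R[i]) : mu \in s ->
  \sum_(k < n.+1) (x k *: nilpart mu k + y k *: nilpart mu k.+1) =
  \sum_(k < n.+1) (x k + (if (k : nat) is j.+1 then y j else 0)) *: nilpart mu k.
Proof.
move=> mus; rewrite big_split /= [in X in _ + X]big_ord_recr /=.
rewrite [X in y n *: X](nilE mus) scaler0 addr0.
under [in RHS]eq_bigr do rewrite scalerDl.
rewrite big_split /=; congr (_ + _).
by rewrite [RHS]big_ord_recl /= scale0r add0r.
Qed.

Lemma Qpow0 a : Qpow a 0 = 1%:M.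
Proof.
transitivity (\sum_(mu <- s) E mu); last exact: sumE.
rewrite /Qpow; apply: eq_big_seq => mu mus.
rewrite big_ord_recl big1 ?addr0.
  by rewrite /qcoef /= plog0 mulr0 cexp0 expr0 !mulr1 scale1r /nilpart expr0 mul1r.
move=> k _; rewrite /qcoef /= sin0 exprS mul0r mulr0 scale0r//.
Qed.

Definition qexp a mu t k : R[i] := cexp ((a - k%:R) * plog mu t) * (sin t)%:C ^+ k.

Lemma qcoefE a mu t k : qcoef a mu t k = cbin a k * qexp a mu t k.
Proof. by rewrite /qcoef /qexp mulrA. Qed.

Lemma pen_qcoef a mu t k : mu \in s ->
  pen mu t * qcoef (a - 1) mu t k = cbin (a - 1) k * qexp a mu t k.
Proof. by move=> mus; rewrite /qcoef /qexp (cexp_shift a t k mus); ring. Qed.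

Lemma sin_qcoef a mu t k :
  (sin t)%:C * qcoef (a - 1) mu t k = cbin (a - 1) k * qexp a mu t k.+1.
Proof.
rewrite /qcoef /qexp exprS -natr1; have -> : a - 1 - k%:R = a - (k%:R + 1) by ring.
by ring.
Qed.

Lemma QpowS a t : mpen V t *m Qpow (a - 1) t = Qpow a t.
Proof.
rewrite /Qpow -[_ *m _]/(mpen V t * _) mulr_sumr; apply: eq_big_seq => mu mus.
rewrite mulr_sumr.
transitivity (\sum_(k < n.+1) ((cbin (a - 1) k * qexp a mu t k) *: nilpart mu k +
    (cbin (a - 1) k * qexp a mu t k.+1) *: nilpart mu k.+1)).
  apply: eq_bigr => k _.
  rewrite mulrDl -[_%:M * _]/(_%:M *m _) mul_scalar_mx -scalerAl -scalerAr mul_nilpart.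
  rewrite -pen_qcoef// -sin_qcoef.
  by apply/matrixP => i j; rewrite !mxE /pen; ring.
rewrite (sum_nilpart_shift (fun k => cbin (a - 1) k * qexp a mu t k)
  (fun k => cbin (a - 1) k * qexp a mu t k.+1))//.
apply: eq_bigr => k _; congr (_ *: _); rewrite qcoefE; case: (nat_of_ord k) => [|j].
  by rewrite addr0.
by rewrite [cbin a _]cbin_pascal mulrDl.
Qed.

Lemma cder_qcoef a mu t k : mu \in s ->
  cder (fun t => qcoef a mu t k) t
    (a * (dpen mu t * qcoef (a - 1) mu t k +
      (if k is j.+1 then (cos t)%:C * qcoef (a - 1) mu t j else 0))).
Proof.
move=> mus; have p0 := pen_neq0 (Im_gt0 mus) t.
have d1 := cderMc (a - k%:R) (cder_plog (Im_gt0 mus) t).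
have d2 := cderM (cderMc (cbin a k) (cder_exp d1)) (cderX k (cder_sinC t)).
apply: (cder_eq d2); rewrite (cexp_shift a t k mus).
rewrite [RHS]mulrDr; congr (_ + _).
  transitivity ((a - k%:R) * cbin a k *
    (dpen mu t * cexp ((a - 1 - k%:R) * plog mu t) * (sin t)%:C ^+ k)); first by field.
  by rewrite -cbin_absorb /qcoef; ring.
rewrite -(cexp_shift a t k mus).
case: k {d1 d2} => [|k]; first by rewrite !mul0r !mulr0.
rewrite /qcoef.
have -> : a * ((cos t)%:C * (cbin (a - 1) k * cexp ((a - 1 - k%:R) * plog mu t) * (sin t)%:C ^+ k))
  = a * cbin (a - 1) k * ((cos t)%:C * cexp ((a - 1 - k%:R) * plog mu t) * (sin t)%:C ^+ k) by ring.
rewrite -cbinS -natr1.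
have -> : a - 1 - k%:R = a - (k%:R + 1) by ring.
by rewrite /=; ring.
Qed.

Lemma Qpow_der a t : mder (Qpow a) t (a *: (dmpen V t *m Qpow (a - 1) t)).
Proof.
move=> i j.
pose dq mu (k : nat) := a * (dpen mu t * qcoef (a - 1) mu t k +
      (if k is j.+1 then (cos t)%:C * qcoef (a - 1) mu t j else 0)).
have -> : a *: (dmpen V t *m Qpow (a - 1) t)
    = \sum_(mu <- s) \sum_(k < n.+1) dq mu k *: nilpart mu k.
  rewrite /Qpow -[_ *m _]/(dmpen V t * _) mulr_sumr scaler_sumr; apply: eq_big_seq => mu mus.
  rewrite mulr_sumr scaler_sumr.
  transitivity (\sum_(k < n.+1) ((a * (dpen mu t * qcoef (a - 1) mu t k)) *: nilpart mu k +
    (a * ((cos t)%:C * qcoef (a - 1) mu t k)) *: nilpart mu k.+1)).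
    apply: eq_bigr => k _.
    rewrite /dmpen mulrDl mulNr -[_%:M * _]/(_%:M *m _) mul_scalar_mx -scalerAl -scalerAr mul_nilpart.
    by apply/matrixP => p q; rewrite !mxE /dpen; ring.
  rewrite (sum_nilpart_shift (fun k => a * (dpen mu t * qcoef (a - 1) mu t k))
    (fun k => a * ((cos t)%:C * qcoef (a - 1) mu t k)))//.
  apply: eq_bigr => k _; congr (_ *: _); rewrite /dq mulrDr.
  by case: (nat_of_ord k) => [|m]; rewrite ?mulr0.
pose S := [seq mu <- s | mu \in s].
have sE : s = S by rewrite /S; apply/esym/all_filterP/allP.
have -> : (fun x => Qpow a x i j) = (fun x => \sum_(mu <- s) \sum_(k < n.+1)
    (if mu \in s then qcoef a mu x k else 0) * nilpart mu k i j).
  apply/funext => x; rewrite /Qpow summxE; apply: eq_big_seq => mu mus.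
  by rewrite summxE mus; apply: eq_bigr => k _; rewrite mxE.
rewrite summxE [X in cder _ _ X](_ : _ = \sum_(mu <- s) \sum_(k < n.+1)
    (if mu \in s then dq mu k else 0) * nilpart mu k i j); last first.
  apply: eq_big_seq => mu mus.
  by rewrite summxE mus; apply: eq_bigr => k _; rewrite mxE.
apply: cder_sum => mu; apply: cder_sum => k.
case: (boolP (mu \in s)) => mus.
  apply: (cder_eq (cderM (cder_qcoef a t k mus) (cder_cst (nilpart mu k i j) t))).
  by rewrite mulr0 addr0.
apply: (cder_eq (cder_cst _ t)); by rewrite mul0r.
Qed.

Lemma Qpow_comm a t : V *m Qpow a t = Qpow a t *m V.
Proof.
apply: commr_sum => mu _; apply: commr_sum => k _.
by rewrite /GRing.comm -scalerAr -scalerAl comm_nilpart.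
Qed.

Lemma pencil_powersP : pencil_powers V Qpow.
Proof. by split; [exact: Qpow0|exact: Qpow_der|exact: QpowS|exact: Qpow_comm]. Qed.

Section Similarity.
Variables (G : 'M[R[i]]_n.+1) (alpha : R).
Hypothesis Gu : G \in unitmx.
Hypothesis alpha_range : 0 < alpha < 2 * pi.

Definition similar_mpen := G *m mpen V alpha *m invmx G.

Lemma eigenvalue_similar mu : eigenvalue V mu -> eigenvalue similar_mpen (pen mu alpha).
Proof.
move=> /eigenvalueP[v vV v0]; apply/eigenvalueP; exists (v *m invmx G).
  rewrite /similar_mpen !mulmxA mulmxKV// mulmxDr mul_mx_scalar -scalemxAr vV.
  by rewrite scalerA -scalerDl -scalemxAl /pen [mu * _]mulrC.
by apply: contra v0 => /eqP h; rewrite -[v](mulmxKV Gu) h mul0mx.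
Qed.

(** For [sin alpha = 0] the pencil is the scalar [cos alpha], which is [pen mu alpha] for
    every [mu]. *)
Lemma similar_eigenvalue nu : eigenvalue similar_mpen nu ->
  exists2 mu, eigenvalue V mu & nu = pen mu alpha.
Proof.
move=> /eigenvalueP[v vX v0].
have w0 : v *m G != 0.
  by apply: contra v0 => /eqP h; rewrite -[v](mulmxK Gu) h mul0mx.
have wP : v *m G *m mpen V alpha = nu *: (v *m G).
  by rewrite scalemxAl -vX /similar_mpen !mulmxA mulmxKV.
rewrite mulmxDr mul_mx_scalar -scalemxAr in wP.
have [sa|sa] := eqVneq (sin alpha) 0.
  have [mu mus] : exists mu, mu \in s.
    case: (s) sumE => [|mu s' _]; last by exists mu; rewrite mem_head.
    by rewrite big_nil => /eqP; rewrite eq_sym oner_eq0.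
  exists mu; first exact: hs.
  rewrite /pen sa mulr0 addr0; move: wP; rewrite sa scale0r addr0 => /eqP.
  by rewrite -subr_eq0 -scalerBl scaler_eq0 (negbTE w0) orbF subr_eq0 => /eqP.
have sc : (sin alpha)%:C != 0 :> R[i] by rewrite eq_complex /= negb_and sa.
exists ((nu - (cos alpha)%:C) / (sin alpha)%:C).
  apply/eigenvalueP; exists (v *m G) => //.
  apply: (scalerI sc); rewrite scalerA mulrC divfK//.
  by rewrite scalerBl -wP addrAC subrr add0r.
by rewrite /pen divfK// addrC subrK.
Qed.

(** On the range of [E mu], [z - P = (z - p) - sin alpha (V - mu)], and the product with the
    geometric sum telescopes. *)
Lemma resolvent_similar z : ~~ eigenvalue similar_mpen z ->
  invmx (z%:M - similar_mpen) = \sum_(mu <- s) \sum_(k < n.+1)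
    (z - pen mu alpha)^-1 ^+ k.+1 *: ((sin alpha)%:C ^+ k *: (G *m nilpart mu k *m invmx G)).
Proof.
move=> zX.
have zp mu : mu \in s -> z - pen mu alpha != 0.
  move=> mus; apply: contra zX; rewrite subr_eq0 => /eqP ->.
  exact/eigenvalue_similar/hs.
pose N := \sum_(mu <- s) \sum_(k < n.+1)
    ((z - pen mu alpha)^-1 ^+ k.+1 * (sin alpha)%:C ^+ k) *: nilpart mu k.
have zN : (z%:M - mpen V alpha) *m N = 1%:M.
  transitivity (\sum_(mu <- s) E mu); last exact: sumE.
  rewrite /N -[_ *m _]/(_ * _) mulr_sumr; apply: eq_big_seq => mu mus.
  rewrite mulr_sumr.
  pose c k : R[i] := (z - pen mu alpha)^-1 ^+ k * (sin alpha)%:C ^+ k.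
  have cS k : c k.+1 = (z - pen mu alpha)^-1 * (sin alpha)%:C * c k.
    by rewrite /c !exprS; ring.
  transitivity (\sum_(k < n.+1) (c k *: nilpart mu k + (- c k.+1) *: nilpart mu k.+1)).
    apply: eq_bigr => k _.
    rewrite /mpen opprD addrA mulrDl -rmorphB -[_%:M * _]/(_%:M *m _) mul_scalar_mx.
    rewrite mulNr -scalerAl -scalerAr mul_nilpart exprS -mulrA -/(c k).
    have := zp mu mus.
    have -> : z - (cos alpha)%:C = (z - pen mu alpha) + mu * (sin alpha)%:C.
      by rewrite /pen; ring.
    rewrite cS; move: (c k) (z - _) (nilpart mu k) (nilpart mu k.+1) => e w B B' w0.
    by apply/matrixP => p q; rewrite !mxE; field.
  rewrite (sum_nilpart_shift c (fun k => - c k.+1))// big_ord_recl big1 ?addr0.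
    by rewrite /c /= !expr0 mul1r scale1r /nilpart expr0 mul1r.
  by move=> k _; rewrite /= subrr scale0r.
have zE : z%:M - similar_mpen = G *m (z%:M - mpen V alpha) *m invmx G.
  by rewrite mulmxBr mulmxBl mul_mx_scalar -scalemxAl mulmxV// scalemx1.
have NE : \sum_(mu <- s) \sum_(k < n.+1)
    (z - pen mu alpha)^-1 ^+ k.+1 *: ((sin alpha)%:C ^+ k *: (G *m nilpart mu k *m invmx G))
    = G *m N *m invmx G.
  rewrite /N mulmx_sumr mulmx_suml; apply: eq_bigr => mu _.
  rewrite mulmx_sumr mulmx_suml; apply: eq_bigr => k _.
  by rewrite scalerA -scalemxAr -scalemxAl.
rewrite NE; have inv : (z%:M - similar_mpen) *m (G *m N *m invmx G) = 1%:M.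
  by rewrite zE !mulmxA mulmxKV// -(mulmxA G) zN mulmx1 mulmxV.
have [u _] := mulmx1_unit inv.
by rewrite -[LHS]mulmx1 -inv mulmxA mulVmx// mul1mx.
Qed.

Lemma similar_arg nu : eigenvalue similar_mpen nu -> nu != 0 /\ 0 < argp nu.
Proof.
move=> /similar_eigenvalue[mu /hV mu0 ->]; split; first exact: pen_neq0.
by have [] := logp_pen mu0 alpha_range.
Qed.

Definition spec_index := [seq (mu, k) | mu <- s, k <- index_iota 0 n.+1].
Definition spec_term (i : R[i] * nat) : 'M[R[i]]_n.+1 :=
  (sin alpha)%:C ^+ i.2 *: (G *m nilpart i.1 i.2 *m invmx G).

Lemma spec_index_eigen i : i \in spec_index -> eigenvalue similar_mpen (pen i.1 alpha).
Proof. by move=> /allpairsPdep[mu [k [mus _ ->]]]; exact/eigenvalue_similar/hs. Qed.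

Lemma resolvent_spec_index z : ~~ eigenvalue similar_mpen z -> invmx (z%:M - similar_mpen) =
  \sum_(i <- spec_index) (z - pen i.1 alpha)^-1 ^+ i.2.+1 *: spec_term i.
Proof.
move=> /resolvent_similar ->; rewrite big_allpairs_dep /=.
by apply: eq_bigr => mu _; rewrite big_mkord.
Qed.

Lemma hfc_cpowp a : hfc (cpowp a) similar_mpen = G *m Qpow a alpha *m invmx G.
Proof.
rewrite (hfc_cpowp_resolvent similar_arg spec_index_eigen resolvent_spec_index).
rewrite big_allpairs_dep /= /Qpow mulmx_sumr mulmx_suml.
apply: eq_big_seq => mu mus; rewrite big_mkord mulmx_sumr mulmx_suml.
apply: eq_bigr => k _; rewrite /spec_term /= scalerA -scalemxAr -scalemxAl.
congr (_ *: _); rewrite /qcoef /cpowp.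
by have [-> _] := logp_pen (Im_gt0 mus) alpha_range.
Qed.

Lemma hfc_cpowm a :
  hfc (cpowm a) (conjmx similar_mpen) = conjmx (G *m Qpow (conjc a) alpha *m invmx G).
Proof.
by rewrite (hfc_cpowm_conj similar_arg spec_index_eigen resolvent_spec_index) hfc_cpowp.
Qed.
End Similarity.
End PencilPowers.

(** The powers followed along the pencil agree at the angle [alpha] with the powers of the
    functional calculus, also after a similarity. *)
Lemma pencil_powers_exist (R : realType) (n : nat) (V : 'M[R[i]]_n.+1) :
  (forall z, eigenvalue V z -> 0 < Im z) ->
  exists2 Q : R[i] -> R -> 'M[R[i]]_n.+1, pencil_powers V Q &
    forall (G : 'M[R[i]]_n.+1) (alpha : R) (a : R[i]), G \in unitmx -> 0 < alpha < 2 * pi ->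
      let X := G *m mpen V alpha *m invmx G in
      hfc (cpowp a) X = G *m Q a alpha *m invmx G /\
      hfc (cpowm a) (conjmx X) = conjmx (G *m Q (conjc a) alpha *m invmx G).
Proof.
move=> hV; have [s [E [hs sumE nilE commE]]] := spectral_projections V.
exists (Qpow V s E); first exact: (pencil_powersP hV hs sumE nilE commE).
move=> G alpha a Gu ar; split.
  exact: (hfc_cpowp hV hs sumE nilE Gu ar).
exact: (hfc_cpowm hV hs sumE nilE Gu ar).
Qed.

(** * First-order equations for the matrix pencil *)

Section MatrixDerivative.
Variable R : realType.
Implicit Types (p q r : nat) (t : R).

Lemma mder_eq p q (M : R -> 'M[R[i]]_(p, q)) t X Y : mder M t X -> X = Y -> mder M t Y.
Proof. by move=> + <-. Qed.

Lemma mder_cst p q (X : 'M[R[i]]_(p, q)) t : mder (fun=> X) t 0.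
Proof. by move=> i j; rewrite mxE; exact: cder_cst. Qed.

Lemma mderD p q (M N : R -> 'M[R[i]]_(p, q)) t X Y :
  mder M t X -> mder N t Y -> mder (fun s => M s + N s) t (X + Y).
Proof.
move=> hM hN i j; under eq_fun do rewrite mxE; rewrite mxE.
by apply: cderD; [exact: hM|exact: hN].
Qed.

Lemma mderN p q (M : R -> 'M[R[i]]_(p, q)) t X : mder M t X -> mder (fun s => - M s) t (- X).
Proof. by move=> hM i j; under eq_fun do rewrite mxE; rewrite mxE; exact: cderN. Qed.

Lemma mderZ p q (c : R -> R[i]) (M : R -> 'M[R[i]]_(p, q)) t d X :
  cder c t d -> mder M t X -> mder (fun s => c s *: M s) t (d *: M t + c t *: X).
Proof.
move=> hc hM i j; under eq_fun do rewrite mxE; rewrite !mxE.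
exact: (cderM hc (hM i j)).
Qed.

Lemma mderM p q r (M : R -> 'M[R[i]]_(p, q)) (N : R -> 'M[R[i]]_(q, r)) t X Y :
  mder M t X -> mder N t Y -> mder (fun s => M s *m N s) t (X *m N t + M t *m Y).
Proof.
move=> hM hN i j; under eq_fun do rewrite mxE; rewrite !mxE -big_split /=.
by apply: cder_sum => k; exact: (cderM (hM i k) (hN k j)).
Qed.

Lemma mder_tr p q (M : R -> 'M[R[i]]_(p, q)) t X : mder M t X -> mder (fun s => (M s)^T) t X^T.
Proof. by move=> hM i j; under eq_fun do rewrite mxE; rewrite mxE; exact: hM. Qed.

Lemma mder_conj p q (M : R -> 'M[R[i]]_(p, q)) t X :
  mder M t X -> mder (fun s => conjmx (M s)) t (conjmx X).
Proof. by move=> hM i j; under eq_fun do rewrite mxE; rewrite mxE; exact: cder_conj. Qed.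

Lemma mder_near p q (M N : R -> 'M[R[i]]_(p, q)) t X :
  (\forall s \near t, M s = N s) -> mder M t X -> mder N t X.
Proof.
by move=> MN hM i j; apply: cder_near (hM i j); apply: filterS MN => s ->.
Qed.

Lemma mder_mpen n (V : 'M[R[i]]_n) t : mder (mpen V) t (dmpen V t).
Proof.
move=> i j; rewrite /mpen /dmpen; under eq_fun do rewrite !mxE; rewrite !mxE.
apply: cderD; last first.
  apply: (cder_eq (cderM (cder_sinC t) (cder_cst (V i j) t))).
  by rewrite mulr0 addr0.
case: (i == j); rewrite ?mulr1n ?mulr0n ?oppr0; first exact: cder_cosC.
exact: cder_cst.
Qed.

Lemma mder_dmpen n (V : 'M[R[i]]_n) t : mder (dmpen V) t (- mpen V t).
Proof.
move=> i j; rewrite /mpen /dmpen; under eq_fun do rewrite !mxE; rewrite !mxE opprD.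
apply: cderD; last first.
  apply: (cder_eq (cderM (cder_cosC t) (cder_cst (V i j) t))).
  by rewrite mulr0 addr0 mulNr.
apply: cderN; case: (i == j); rewrite ?mulr1n ?mulr0n ?oppr0; first exact: cder_sinC.
exact: cder_cst.
Qed.

Lemma mder0_cst_on p q (M : R -> 'M[R[i]]_(p, q)) (a b : R) :
  (forall t, a <= t <= b -> mder M t 0) -> forall t, a <= t <= b -> M t = M a.
Proof.
move=> h t tab; apply/matrixP => i j.
apply: (@cder0_cst_on _ (fun s => M s i j) a b) => // s sab.
by have := h s sab i j; rewrite mxE.
Qed.

Lemma mpen_mul n p (V : 'M[R[i]]_n) t (w : 'M[R[i]]_(n, p)) :
  mpen V t *m w = (cos t)%:C *: w + (sin t)%:C *: (V *m w).
Proof. by rewrite /mpen; move: _%:C _%:C => c s; rewrite mulmxDl mul_scalar_mx -scalemxAl. Qed.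

Lemma dmpen_mul n p (V : 'M[R[i]]_n) t (w : 'M[R[i]]_(n, p)) :
  dmpen V t *m w = - ((sin t)%:C *: w) + (cos t)%:C *: (V *m w).
Proof.
rewrite /dmpen; move: _%:C _%:C => c s.
by rewrite mulmxDl mulNmx mul_scalar_mx -scalemxAl.
Qed.

Lemma comm_mpen n (V X : 'M[R[i]]_n) t : V *m X = X *m V -> mpen V t *m X = X *m mpen V t.
Proof.
by move=> h; rewrite mulmxDl mulmxDr mul_scalar_mx mul_mx_scalar -scalemxAl -scalemxAr h.
Qed.

Lemma comm_dmpen n (V X : 'M[R[i]]_n) t : V *m X = X *m V -> dmpen V t *m X = X *m dmpen V t.
Proof.
move=> h; rewrite mulmxDl mulmxDr mulNmx mulmxN mul_scalar_mx mul_mx_scalar.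
by rewrite -scalemxAl -scalemxAr h.
Qed.

Lemma mpen_dmpen n (V : 'M[R[i]]_n) s t : mpen V s *m dmpen V t = dmpen V t *m mpen V s.
Proof. by apply: comm_mpen; rewrite comm_dmpen. Qed.

Lemma dmpen0 n (V : 'M[R[i]]_n) : dmpen V 0 = V.
Proof. by rewrite /dmpen cos0 sin0 scale1r raddf0 oppr0 add0r. Qed.

End MatrixDerivative.

Section FirstOrderEquation.
Variables (R : realType) (n : nat) (V : 'M[R[i]]_n) (Q : R[i] -> R -> 'M[R[i]]_n).
Hypothesis hQ : pencil_powers V Q.
Implicit Types (t : R) (a : R[i]).

(** The first-order operator [a P' x - P y], where [y] stands for the derivative of [x]:
    up to a power of [r], this is [V d1 - d2] applied to [r^a x(t)]. *)
Definition residual a p (x y : 'M[R[i]]_(n, p)) t : 'M[R[i]]_(n, p) :=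
  a *: (dmpen V t *m x) - mpen V t *m y.

Lemma pencil_power0E t : 0 <= t -> Q 0 t = 1%:M.
Proof.
move=> t0; rewrite -(pencil_powers0 hQ 0).
apply: (@mder0_cst_on _ _ _ (Q 0) 0 t) => [s _|]; last by rewrite t0 lexx.
by apply: (mder_eq (pencil_powers_der hQ 0 s)); rewrite scale0r.
Qed.

Lemma mpen_inj p t (X Y : 'M[R[i]]_(n, p)) : 0 <= t ->
  mpen V t *m X = mpen V t *m Y -> X = Y.
Proof.
move=> t0; have := pencil_powersS hQ 0 t; rewrite pencil_power0E// => PQ.
have [Pu _] := mulmx1_unit PQ.
by move=> h; rewrite -[X](mulKmx Pu) h mulKmx.
Qed.

Lemma mpen_comm a t s : mpen V s *m Q a t = Q a t *m mpen V s.
Proof. exact/comm_mpen/(pencil_powers_comm hQ). Qed.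

Lemma dmpen_comm a t s : dmpen V s *m Q a t = Q a t *m dmpen V s.
Proof. exact/comm_dmpen/(pencil_powers_comm hQ). Qed.

(** All the matrices commute, so [P] times the derivative of [Q (- a) * y] is
    [- a P' Q (- a) y + Q (- a) P y'], which the equation for [y] makes zero. *)
Lemma pencil_power_first_integral a p (y y1 : R -> 'M[R[i]]_(n, p)) (alpha : R) :
  (forall t, 0 <= t <= alpha -> mder y t (y1 t) /\ residual a (y t) (y1 t) t = 0) ->
  forall t, 0 <= t <= alpha -> Q (- a) t *m y t = y 0.
Proof.
move=> hy t ht; rewrite -[RHS]mul1mx -(pencil_powers0 hQ (- a)).
apply: (@mder0_cst_on _ _ _ (fun t => Q (- a) t *m y t) 0 alpha) => // {ht}t ht.
have [dy ry] := hy t ht; have t0 : 0 <= t by case/andP: ht.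
apply: (mder_eq (mderM (pencil_powers_der hQ (- a) t) dy)).
apply: (mpen_inj t0); rewrite mulmx0 mulmxDr -scalemxAl -scalemxAr !mulmxA.
rewrite mpen_dmpen -[dmpen V t *m mpen V t *m _]mulmxA (pencil_powersS hQ).
rewrite mpen_comm -[Q _ _ *m _ *m y1 t]mulmxA.
move/eqP: ry; rewrite subr_eq0 => /eqP <-.
by rewrite -scalemxAr mulmxA -dmpen_comm scaleNr addNr.
Qed.

Lemma pencil_power_residual a p (c : 'M[R[i]]_(n, p)) t :
  residual a (Q a t *m c) (a *: (dmpen V t *m Q (a - 1) t) *m c) t = 0.
Proof.
rewrite /residual -scalemxAl -scalemxAr -scalerBr -(pencil_powersS hQ a).
by rewrite !mulmxA mpen_dmpen subrr scaler0.
Qed.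

(** [Q (- a)] is a first integral and is inverted by [Q a]: apply the first integral to the
    solution [Q (- a)] itself. *)
Lemma first_order_solution a p (y y1 : R -> 'M[R[i]]_(n, p)) (alpha : R) :
  (forall t, 0 <= t <= alpha -> mder y t (y1 t) /\ residual a (y t) (y1 t) t = 0) ->
  forall t, 0 <= t <= alpha -> y t = Q a t *m y 0.
Proof.
move=> hy t ht; rewrite -(pencil_power_first_integral hy ht) mulmxA.
have -> : Q a t *m Q (- a) t = 1%:M; last by rewrite mul1mx.
have h := @pencil_power_first_integral (- a) _ (Q (- a))
  (fun t => - a *: (dmpen V t *m Q (- a - 1) t)) alpha.
rewrite -(pencil_powers0 hQ (- a)) -(h _ t ht) ?opprK// => s _; split.
  exact: (pencil_powers_der hQ).
by have := pencil_power_residual (- a) (1%:M : 'M[R[i]]_n) s; rewrite !mulmx1.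
Qed.
End FirstOrderEquation.

Section RelatedPencils.
Variables (R : realType) (n : nat) (V : 'M[R[i]]_n) (Q : R[i] -> R -> 'M[R[i]]_n).
Hypothesis hQ : pencil_powers V Q.
Implicit Types (t : R) (a : R[i]).

Lemma conjmx_mpen t : conjmx (mpen V t) = mpen (conjmx V) t.
Proof. by rewrite /mpen conjmatD conjmatZ conjmat_scalar !conjc_real. Qed.

Lemma conjmx_dmpen t : conjmx (dmpen V t) = dmpen (conjmx V) t.
Proof. by rewrite /dmpen conjmatD conjmatZ conjmatN conjmat_scalar !conjc_real. Qed.

Lemma pencil_powers_conj :
  pencil_powers (conjmx V) (fun a t => conjmx (Q (conjc a) t)).
Proof.
have c1 a : conjc (a - 1) = conjc a - 1 by rewrite rmorphB rmorph1.
split=> a => [|t|t|t].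
- by rewrite (pencil_powers0 hQ) conjmat_scalar conjc1.
- apply: (mder_eq (mder_conj (pencil_powers_der hQ (conjc a) t))).
  by rewrite conjmatZ conjcK conjmatM conjmx_dmpen c1.
- by rewrite -conjmx_mpen -conjmatM c1 (pencil_powersS hQ).
- by rewrite -!conjmatM (pencil_powers_comm hQ).
Qed.

(** Conjugate and transpose together give the powers for the left factor, whose matrix is the
    adjoint of [V]. *)
Lemma pencil_powers_tr : pencil_powers V^T (fun a t => (Q a t)^T).
Proof.
have trm t : mpen V^T t = (mpen V t)^T.
  by rewrite /mpen linearD linearZ /= tr_scalar_mx.
have trdm t : dmpen V^T t = (dmpen V t)^T.
  by rewrite /dmpen linearD linearN linearZ /= tr_scalar_mx.
split=> a => [|t|t|t].
- by rewrite (pencil_powers0 hQ) trmx1.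
- apply: (mder_eq (mder_tr (pencil_powers_der hQ a t))).
  by rewrite linearZ /= (dmpen_comm hQ) trmx_mul trdm.
- by rewrite trm -trmx_mul -(mpen_comm hQ) (pencil_powersS hQ).
- by rewrite -!trmx_mul (pencil_powers_comm hQ).
Qed.
End RelatedPencils.

(** * Homogeneous functions in polar coordinates *)

Section PolarCoordinates.
Variables (R : realType) (l : nat).
Implicit Types (t r phi : R) (lam : R[i]) (w : R -> 'cV[R[i]]_l).

Lemma sum_ord2 (T : zmodType) (F : 'I_2 -> T) : \sum_(i < 2) F i = F 0 + F 1.
Proof.
rewrite big_ord_recl big_ord1; congr (F _ + F _); exact: val_inj.
Qed.

Lemma mder_vderive w t d : mder w t d -> vderive w t = d.
Proof.
move=> h; apply/colP => k; rewrite mxE; have [[_ hr] [_ hi]] := h k 0.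
by rewrite !derive1E hr hi; case: (d k 0).
Qed.

Lemma cder_rpow lam r : 0 < r -> cder (rpow lam) r (lam * rpow (lam - 1) r).
Proof.
move=> r0; have r0' : r%:C != 0 by rewrite eq_complex /= gt_eqF.
apply: (cder_eq (cder_exp (cderMc lam (cder_real (is_derive1_ln r0))))).
rewrite /rpow mulrBl mul1r cexpD cexpN.
have -> : cexp (ln r)%:C = r%:C.
  by apply: complex_ext; rewrite /= ?cos0 ?sin0 ?mulr1 ?mulr0 ?lnK.
have -> : (r^-1)%:C = (r%:C)^-1 by rewrite fmorphV.
by ring.
Qed.

Lemma rpowB1 lam r : 0 < r -> rpow lam r = r%:C * rpow (lam - 1) r.
Proof.
move=> r0; have -> : r%:C = cexp (ln r)%:C.
  by apply: complex_ext; rewrite /= ?cos0 ?sin0 ?mulr1 ?mulr0 ?lnK.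
by rewrite /rpow -cexpD; congr cexp; ring.
Qed.

(** [frame 0] and [frame 1] are the components of the radial unit vector, the derivatives
    [dframe] those of the angular one. *)
Definition frame (j : 'I_2) phi : R[i] := if j == 0 then (cos phi)%:C else (sin phi)%:C.
Definition dframe (j : 'I_2) phi : R[i] := if j == 0 then - (sin phi)%:C else (cos phi)%:C.

Lemma cder_frame j phi : cder (frame j) phi (dframe j phi).
Proof. by rewrite /frame /dframe; case: ifP => _; [exact: cder_cosC|exact: cder_sinC]. Qed.

Lemma cder_dframe j phi : cder (dframe j) phi (- frame j phi).
Proof.
rewrite /frame /dframe; case: ifP => _; last exact: cder_cosC.
exact: (cderN (cder_sinC phi)).
Qed.

(** The angular part of the Cartesian derivatives of [r^lam w(phi)], in terms of the
    values [x] and [y] of [w] and of its derivative. *)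
Definition angular (j : 'I_2) lam (x y : 'cV[R[i]]_l) phi : 'cV[R[i]]_l :=
  (lam * frame j phi) *: x + dframe j phi *: y.

Lemma partial_x_homogeneous (j : 'I_2) (u : R -> R -> 'cV[R[i]]_l) lam w phi d r :
  (forall s t, 0 < s -> u s t = rpow lam s *: w t) -> mder w phi d -> 0 < r ->
  partial_x j u r phi = rpow (lam - 1) r *: angular j lam (w phi) d phi.
Proof.
move=> hu hw r0; have r0' : r%:C != 0 by rewrite eq_complex /= gt_eqF.
have d1 : vderive (fun s => u s phi) r = (lam * rpow (lam - 1) r) *: w phi.
  apply: mder_vderive.
  apply: (@mder_near _ _ _ (fun s => rpow lam s *: w phi)).
    by near=> s; rewrite hu//; near: s; exact: lt_nbhsr.
  apply: (mder_eq (mderZ (cder_rpow lam r0) (mder_cst (w phi) r))).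
  by rewrite scaler0 addr0.
have d2 : vderive (fun s => u r s) phi = rpow lam r *: d.
  apply: mder_vderive.
  rewrite (_ : (fun s => u r s) = (fun s => rpow lam r *: w s)); last first.
    by apply/funext => s; rewrite hu.
  apply: (mder_eq (mderZ (cder_cst (rpow lam r) phi) hw)).
  by rewrite scale0r add0r.
have dr (x : R) : (x / r)%:C = x%:C / r%:C by rewrite rmorphM fmorphV.
rewrite /partial_x /angular /frame /dframe d1 d2 (rpowB1 lam r0) !dr.
by case: ifP => _; apply/colP => k; rewrite !mxE; field.
Unshelve. all: by end_near. Qed.

(** The angular part of a second Cartesian derivative of [r^lam w(phi)]. *)
Definition angular2 (i j : 'I_2) lam (x y z : 'cV[R[i]]_l) phi : 'cV[R[i]]_l :=
  (lam * ((lam - 1) * frame i phi * frame j phi + dframe i phi * dframe j phi)) *: x +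
  ((lam - 1) * (frame i phi * dframe j phi + dframe i phi * frame j phi)) *: y +
  (dframe i phi * dframe j phi) *: z.

(** The equation [L_A (r^lam v) = 0] on the level of the angular function, [x], [y]
    and [z] being the values of [v] and of its first two derivatives. *)
Definition angular_op (A11 A12 : 'M[R]_l) lam (x y z : 'cV[R[i]]_l) phi : 'cV[R[i]]_l :=
  \sum_(i < 2) \sum_(j < 2) toC (tuple_coef A11 A12 i j) *m angular2 i j lam x y z phi.

Lemma elliptic_op_power (A11 A12 : 'M[R]_l) lam v v1 v2 r phi :
  (forall t, mder v t (v1 t)) -> (forall t, mder v1 t (v2 t)) -> 0 < r ->
  elliptic_op A11 A12 (power_fun lam v) r phi
  = rpow (lam - 1 - 1) r *: angular_op A11 A12 lam (v phi) (v1 phi) (v2 phi) phi.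
Proof.
move=> h1 h2 r0; rewrite /elliptic_op /angular_op scaler_sumr; apply: eq_bigr => i _.
rewrite scaler_sumr; apply: eq_bigr => j _; rewrite scalemxAr; congr (_ *m _).
have da := mderD (mderZ (cderMc lam (cder_frame j phi)) (h1 phi))
  (mderZ (cder_dframe j phi) (h2 phi)).
rewrite (@partial_x_homogeneous i _ (lam - 1) (fun t => angular j lam (v t) (v1 t) t) phi _ r _ da)//.
  congr (_ *: _); rewrite /angular /angular2.
  by apply/colP => k; rewrite !mxE; ring.
by move=> s t s0; exact: (@partial_x_homogeneous j _ lam v).
Qed.

Lemma conormal_power (A11 A12 : 'M[R]_l) lam v v1 r :
  (forall t, mder v t (v1 t)) -> 0 < r ->
  conormal A11 A12 (power_fun lam v) r 0
  = rpow (lam - 1) r *: (lam *: (toC A12 *m v 0) + v1 0).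
Proof.
move=> h1 r0.
have p j : partial_x j (power_fun lam v) r 0
    = rpow (lam - 1) r *: angular j lam (v 0) (v1 0) 0.
  by apply: (@partial_x_homogeneous j _ lam v).
have n0 : (normal 0 0)%:C = 0 :> R[i] by rewrite /normal eqxx sin0 oppr0.
have n1 : (normal 0 1)%:C = 1 :> R[i] by rewrite /normal cos0.
have toC1 : toC 1%:M = 1%:M :> 'M[R[i]]_l by rewrite /toC map_scalar_mx.
have -> : conormal A11 A12 (power_fun lam v) r 0 =
    toC A12 *m partial_x 0 (power_fun lam v) r 0 + partial_x 1 (power_fun lam v) r 0.
  rewrite /conormal !sum_ord2 n0 n1 !scale0r !scale1r !add0r.
  by rewrite -[tuple_coef _ _ 1 0]/A12 -[tuple_coef _ _ 1 1]/1%:M toC1 mul1mx.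
have f0 : frame 0 0 = 1 by rewrite /frame eqxx cos0.
have f1 : frame 1 0 = 0 by rewrite /frame /= sin0.
have g0 : dframe 0 0 = 0 by rewrite /dframe eqxx sin0 oppr0.
have g1 : dframe 1 0 = 1 by rewrite /dframe /= cos0.
rewrite !p /angular f0 f1 g0 g1 mulr0 mulr1 !scale0r scale1r add0r addr0.
by rewrite -!scalemxAr -scalerDr.
Qed.

Lemma angular_opB (A11 A12 : 'M[R]_l) lam x y z x' y' z' phi :
  angular_op A11 A12 lam (x - x') (y - y') (z - z') phi =
  angular_op A11 A12 lam x y z phi - angular_op A11 A12 lam x' y' z' phi.
Proof.
rewrite /angular_op -sumrB; apply: eq_bigr => i _; rewrite -sumrB.
apply: eq_bigr => j _; rewrite -mulmxBr; congr (_ *m _).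
rewrite /angular2; apply/colP => k; rewrite !mxE.
by ring.
Qed.

Section Factorization.
Variables (A11 A12 : 'M[R]_l) (U V : 'M[R[i]]_l).
Hypothesis A11E : toC A11 = U *m V.
Hypothesis A12E : toC A12 = - (2^-1 *: (U + V)).

(** The factorization of the symbol factorizes the operator, since the constant
    matrices commute with the derivatives. *)
Lemma angular_op_factor lam x y z phi :
  angular_op A11 A12 lam x y z phi =
  residual U (lam - 1) (residual V lam x y phi)
    (residual V lam y z phi - (lam *: (mpen V phi *m x) + dmpen V phi *m y)) phi.
Proof.
have half : (2^-1 : R[i]) * 2 = 1 by rewrite mulVf// pnatr_eq0.
transitivity (U *m (V *m angular2 0 0 lam x y z phi) - U *m angular2 0 1 lam x y z phi
  - V *m angular2 0 1 lam x y z phi + angular2 1 1 lam x y z phi).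
  have -> : angular_op A11 A12 lam x y z phi = toC A11 *m angular2 0 0 lam x y z phi +
    toC A12 *m (2 *: angular2 0 1 lam x y z phi) + angular2 1 1 lam x y z phi.
    rewrite /angular_op !sum_ord2.
    rewrite -[tuple_coef _ _ 0 0]/A11 -[tuple_coef _ _ 0 1]/A12.
    rewrite -[tuple_coef _ _ 1 0]/A12 -[tuple_coef _ _ 1 1]/1%:M.
    have -> : angular2 1 0 lam x y z phi = angular2 0 1 lam x y z phi.
      by rewrite /angular2; apply/colP => k; rewrite !mxE; ring.
    have -> : toC 1%:M = 1%:M :> 'M[R[i]]_l by rewrite /toC map_scalar_mx.
    move: (angular2 0 0 _ _ _ _ _) (angular2 0 1 _ _ _ _ _) (angular2 1 1 _ _ _ _ _) => a b c.
    by rewrite mul1mx scaler_nat mulr2n mulmxDr !addrA.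
  move: (angular2 0 0 _ _ _ _ _) (angular2 0 1 _ _ _ _ _) (angular2 1 1 _ _ _ _ _) => a b c.
  rewrite A11E A12E mulNmx -scalemxAl -scalemxAr scalerA half scale1r mulmxDl.
  by rewrite opprD mulmxA !addrA.
have lin3 (W : 'M[R[i]]_l) (a b c : R[i]) : W *m (a *: x + b *: y + c *: z) =
    a *: (W *m x) + b *: (W *m y) + c *: (W *m z).
  by rewrite !mulmxDr -!scalemxAr.
have rE (W : 'M[R[i]]_l) k (w w' : 'cV[R[i]]_l) : residual W k w w' phi =
    W *m ((k * (cos phi)%:C) *: w - (sin phi)%:C *: w')
    - ((k * (sin phi)%:C) *: w + (cos phi)%:C *: w').
  rewrite /residual mpen_mul dmpen_mul mulmxBr -!scalemxAr; move: (W *m w) (W *m w') => P P'.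
  by apply/colP => k'; rewrite !mxE; ring.
transitivity (U *m (V *m angular2 0 0 lam x y z phi - angular2 0 1 lam x y z phi)
  - (V *m angular2 0 1 lam x y z phi - angular2 1 1 lam x y z phi)).
  move: (angular2 0 0 _ _ _ _ _) (angular2 0 1 _ _ _ _ _) (angular2 1 1 _ _ _ _ _) => a b c.
  by rewrite mulmxBr opprB addrA addrAC.
have rV (w w' : 'cV[R[i]]_l) : residual V lam w w' phi = ((lam * (cos phi)%:C) *: (V *m w) - (sin phi)%:C *: (V *m w'))
    - ((lam * (sin phi)%:C) *: w + (cos phi)%:C *: w').
  by rewrite rE mulmxBr -!scalemxAr.
rewrite [RHS]rE (rV x y) (rV y z) (mpen_mul V phi x) (dmpen_mul V phi y).
rewrite /angular2.
rewrite !lin3.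
rewrite /frame /dframe !eqxx.
rewrite (_ : ((1 : 'I_2) == 0) = false)//.
by congr (U *m _ - _); move: (V *m x) (V *m y) (V *m z) => X Y Z;
  apply/colP => k; rewrite !mxE; ring.
Qed.
End Factorization.
End PolarCoordinates.

(** * The solution space of the elliptic system *)

Section Smoothness.
Variable R : realType.
Implicit Types (t : R) (g : R -> R[i]).

(** Induction on the order, replacing the function by its derivative in the class. *)
Lemma smooth_class (P : (R -> R[i]) -> Prop) :
  (forall g, P g -> exists2 g', P g' & forall t, cder g t (g' t)) ->
  forall g, P g -> forall (n : nat) t,
    derivable ((fun s => Re (g s))^`(n)%classic) t 1 /\
    derivable ((fun s => Im (g s))^`(n)%classic) t 1.
Proof.
move=> closedP g Pg n; elim: n g Pg => [|n IH] g Pg t.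
  by have [g' _ /(_ t)/cder_derivable] := closedP g Pg.
have [g' Pg' dg] := closedP g Pg.
have er : (fun s => Re (g s))^`()%classic = fun s => Re (g' s).
  by apply/funext => s; rewrite derive1E; case: (dg s) => -[_ ->].
have ei : (fun s => Im (g s))^`()%classic = fun s => Im (g' s).
  by apply/funext => s; rewrite derive1E; case: (dg s) => _ [_ ->].
by rewrite !derive1Sn er ei; exact: IH.
Qed.

Lemma derivable_derive1 (h : R -> R) t : derivable h t 1 -> is_derive t 1 h (h^`()%classic t).
Proof. by rewrite derive1E; exact: derivableP. Qed.

Lemma smooth_vec_mder (l : nat) (v : R -> 'cV[R[i]]_l) : smooth_vec v ->
  (forall t, mder v t (vderive v t)) /\
  (forall t, mder (vderive v) t (vderive (vderive v) t)).
Proof.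
move=> sv; split=> t k j; rewrite (ord1 j) mxE.
  have [dr di] := sv 0 k t; split=> /=.
    exact: (derivable_derive1 dr).
  exact: (derivable_derive1 di).
have e1 : (fun s => Re (vderive v s k 0)) = (fun s => Re (v s k 0))^`()%classic.
  by apply/funext => s; rewrite mxE.
have e2 : (fun s => Im (vderive v s k 0)) = (fun s => Im (v s k 0))^`()%classic.
  by apply/funext => s; rewrite mxE.
have [dr di] := sv 1 k t; rewrite /cder !e1 !e2.
by rewrite !derive1n1 in dr di; split; [exact: (derivable_derive1 dr)|exact: (derivable_derive1 di)].
Qed.

Section PencilSmooth.
Variables (n : nat) (V : 'M[R[i]]_n) (Q : R[i] -> R -> 'M[R[i]]_n).
Hypothesis hQ : pencil_powers V Q.

(** The entries of the solutions generate this class; by the equation for [Q a], it is closed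
    under differentiation. *)
Inductive pencil_class : (R -> R[i]) -> Prop :=
| class_cst c : pencil_class (fun=> c)
| class_cos : pencil_class (fun t => (cos t)%:C)
| class_sin : pencil_class (fun t => (sin t)%:C)
| class_pow a i j : pencil_class (fun t => Q a t i j)
| class_conj g of pencil_class g : pencil_class (fun t => conjc (g t))
| class_add g h of pencil_class g & pencil_class h : pencil_class (fun t => g t + h t)
| class_mul g h of pencil_class g & pencil_class h : pencil_class (fun t => g t * h t).

Lemma class_sum (I : Type) (s : seq I) (F : I -> R -> R[i]) :
  (forall i, pencil_class (F i)) -> pencil_class (fun t => \sum_(i <- s) F i t).
Proof.
move=> hF; elim: s => [|i s IH].
  by under eq_fun do rewrite big_nil; exact: class_cst.
by under eq_fun do rewrite big_cons; exact: class_add.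
Qed.

Lemma pencil_class_derive g : pencil_class g ->
  exists2 g', pencil_class g' & forall t, cder g t (g' t).
Proof.
elim=> {g} [c|||a i j|g _ [g' cg' dg]|g h cg [g' cg' dg] ch [h' ch' dh]
  |g h cg [g' cg' dg] ch [h' ch' dh]].
- by exists (fun=> 0); [exact: class_cst|move=> t; exact: cder_cst].
- exists (fun t => -1 * (sin t)%:C); first by apply: class_mul; [exact: class_cst|exact: class_sin].
  by move=> t; rewrite mulN1r; exact: cder_cosC.
- by exists (fun t => (cos t)%:C); [exact: class_cos|move=> t; exact: cder_sinC].
- exists (fun t => a * \sum_k (-1 * (sin t)%:C * (i == k)%:R + (cos t)%:C * V i k) * Q (a - 1) t k j).
    apply: class_mul; first exact: class_cst.
    apply: class_sum => k; apply: class_mul; last exact: class_pow.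
    apply: class_add; apply: class_mul; try exact: class_cst; last exact: class_cos.
    by apply: class_mul; [exact: class_cst|exact: class_sin].
  move=> t; apply: (cder_eq (pencil_powers_der hQ a t i j)).
  rewrite !mxE; congr (_ * _); apply: eq_bigr => k _; rewrite !mxE.
  by congr (_ * _); rewrite mulN1r mulr_natr mulNrn.
- exists (fun t => conjc (g' t)); first exact: class_conj.
  by move=> t; exact: cder_conj.
- exists (fun t => g' t + h' t); first exact: class_add.
  by move=> t; exact: cderD.
- exists (fun t => g' t * h t + g t * h' t).
    by apply: class_add; apply: class_mul.
  by move=> t; exact: cderM.
Qed.
End PencilSmooth.
End Smoothness.

Section SolutionSpace.
Variables (R : realType) (l : nat) (A11 A12 : 'M[R]_l) (U V : 'M[R[i]]_l).
Variable Q : R[i] -> R -> 'M[R[i]]_l.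
Implicit Types (t : R) (lam : R[i]).
Hypothesis UE : U = (conjmx V)^T.
Hypothesis A11E : toC A11 = U *m V.
Hypothesis A12E : toC A12 = - (2^-1 *: (U + V)).
Hypothesis hQ : pencil_powers V Q.

Definition Qbar lam t : 'M[R[i]]_l := conjmx (Q (conjc lam) t).

Lemma Qbar_powers : pencil_powers (conjmx V) Qbar.
Proof. exact: pencil_powers_conj. Qed.

Lemma mder_residual (W : 'M[R[i]]_l) lam (q q1 q2 : R -> 'cV[R[i]]_l) t :
  (forall s, mder q s (q1 s)) -> (forall s, mder q1 s (q2 s)) ->
  mder (fun s => residual W lam (q s) (q1 s) s) t
    (residual W lam (q1 t) (q2 t) t - (lam *: (mpen W t *m q t) + dmpen W t *m q1 t)).
Proof.
move=> d1 d2.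
have h1 := mderZ (cder_cst lam t) (mderM (mder_dmpen W t) (d1 t)).
have h2 := mderM (mder_mpen W t) (d2 t).
apply: (mder_eq (mderD h1 (mderN h2))); rewrite /residual.
rewrite scale0r add0r mulNmx scalerDr scalerN !opprD.
by rewrite addrACA [RHS]addrC -!addrA; congr (_ + _); rewrite addrCA.
Qed.

Lemma mder_uniq p q (M : R -> 'M[R[i]]_(p, q)) t X Y : mder M t X -> mder M t Y -> X = Y.
Proof. by move=> hX hY; apply/matrixP => i j; exact: cder_uniq (hX i j) (hY i j). Qed.

(** The right factor yields the zero function, whose derivative is zero as well. *)
Lemma angular_op_residual0 (U' W : 'M[R[i]]_l) lam (q q1 q2 : R -> 'cV[R[i]]_l) t :
  toC A11 = U' *m W -> toC A12 = - (2^-1 *: (U' + W)) ->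
  (forall s, mder q s (q1 s)) -> (forall s, mder q1 s (q2 s)) ->
  (forall s, residual W lam (q s) (q1 s) s = 0) ->
  angular_op A11 A12 lam (q t) (q1 t) (q2 t) t = 0.
Proof.
move=> e11 e12 d1 d2 r0; rewrite (angular_op_factor e11 e12) r0.
have := mder_residual W lam t d1 d2.
have -> : (fun s => residual W lam (q s) (q1 s) s) = (fun=> 0) by apply/funext => s; rewrite r0.
move=> /(mder_uniq (mder_cst 0 t)) <-.
by rewrite /residual !mulmx0 scaler0 subrr.
Qed.

Definition solution lam (c c' : 'cV[R[i]]_l) t := Q lam t *m c + Qbar lam t *m c'.

Definition pow1 (W : 'M[R[i]]_l) (P : R[i] -> R -> 'M[R[i]]_l) lam (c : 'cV[R[i]]_l) t :=
  lam *: (dmpen W t *m P (lam - 1) t) *m c.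
Definition pow2 (W : 'M[R[i]]_l) (P : R[i] -> R -> 'M[R[i]]_l) lam (c : 'cV[R[i]]_l) t :=
  lam *: (- mpen W t *m P (lam - 1) t +
    dmpen W t *m ((lam - 1) *: (dmpen W t *m P (lam - 1 - 1) t))) *m c.

Lemma mder_pow (W : 'M[R[i]]_l) P lam c t : pencil_powers W P ->
  mder (fun t => P lam t *m c) t (pow1 W P lam c t).
Proof.
move=> hP; apply: (mder_eq (mderM (pencil_powers_der hP lam t) (mder_cst c t))).
by rewrite mulmx0 addr0.
Qed.

Lemma mder_pow1 (W : 'M[R[i]]_l) P lam c t : pencil_powers W P ->
  mder (pow1 W P lam c) t (pow2 W P lam c t).
Proof.
move=> hP.
have h := mderM (mderZ (cder_cst lam t)
  (mderM (mder_dmpen W t) (pencil_powers_der hP (lam - 1) t))) (mder_cst c t).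
by apply: (mder_eq h); rewrite scale0r add0r mulmx0 addr0.
Qed.

Definition solution1 lam (c c' : 'cV[R[i]]_l) t :=
  pow1 V Q lam c t + pow1 (conjmx V) Qbar lam c' t.
Definition solution2 lam (c c' : 'cV[R[i]]_l) t :=
  pow2 V Q lam c t + pow2 (conjmx V) Qbar lam c' t.

Lemma mder_solution lam c c' t : mder (solution lam c c') t (solution1 lam c c' t).
Proof. by apply: mderD; apply: mder_pow => //; exact: Qbar_powers. Qed.

Lemma mder_solution1 lam c c' t : mder (solution1 lam c c') t (solution2 lam c c' t).
Proof. by apply: mderD; apply: mder_pow1 => //; exact: Qbar_powers. Qed.

(** Conjugation of the factorization, the coefficients being real. *)
Lemma conj_factor : toC A11 = V^T *m conjmx V /\ toC A12 = - (2^-1 *: (V^T + conjmx V)).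
Proof.
have cU : conjmx U = V^T by rewrite UE -[in RHS](conjmatK V); apply/matrixP => i j; rewrite !mxE.
rewrite -(conjmat_toC A11) -(conjmat_toC A12) A11E A12E conjmatM conjmatN conjmatZ conjmatD cU.
by rewrite conjc_inv rmorph_nat.
Qed.

Lemma solution_angular_op lam c c' t :
  angular_op A11 A12 lam (solution lam c c' t) (solution1 lam c c' t) (solution2 lam c c' t) t = 0.
Proof.
have [e11 e12] := conj_factor.
have h1 : angular_op A11 A12 lam (Q lam t *m c) (pow1 V Q lam c t) (pow2 V Q lam c t) t = 0.
  apply: (@angular_op_residual0 U V lam (fun t => Q lam t *m c) (pow1 V Q lam c)) => // s.
  - exact: mder_pow.
  - exact: mder_pow1.
  - exact: pencil_power_residual.
have h2 : angular_op A11 A12 lam (- (Qbar lam t *m c')) (- pow1 (conjmx V) Qbar lam c' t)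
    (- pow2 (conjmx V) Qbar lam c' t) t = 0.
  rewrite -[- (Qbar _ _ *m _)]sub0r -[- pow1 _ _ _ _ _]sub0r -[- pow2 _ _ _ _ _]sub0r angular_opB.
  rewrite (@angular_op_residual0 V^T (conjmx V) lam (fun t => Qbar lam t *m c')
    (pow1 (conjmx V) Qbar lam c') (pow2 (conjmx V) Qbar lam c'))//.
  - rewrite subr0 /angular_op big1// => i _; rewrite big1// => j _.
    by rewrite /angular2 !scaler0 !addr0 mulmx0.
  - by move=> s; apply: mder_pow; exact: Qbar_powers.
  - by move=> s; apply: mder_pow1; exact: Qbar_powers.
  - by move=> s; apply: pencil_power_residual; exact: Qbar_powers.
rewrite /solution /solution1 /solution2.
rewrite -[Qbar lam t *m c']opprK -[pow1 (conjmx V) _ _ _ _]opprK -[pow2 (conjmx V) _ _ _ _]opprK.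
by rewrite angular_opB h1 h2 subrr.
Qed.

Lemma solution0 lam c c' : solution lam c c' 0 = c + c'.
Proof. by rewrite /solution (pencil_powers0 hQ) (pencil_powers0 Qbar_powers) !mul1mx. Qed.

Lemma solution10 lam c c' : solution1 lam c c' 0 = lam *: (V *m c + conjmx V *m c').
Proof.
rewrite /solution1 /pow1 (pencil_powers0 hQ) (pencil_powers0 Qbar_powers) !dmpen0 !mulmx1.
by rewrite -!scalemxAl scalerDr.
Qed.

Lemma solution_smooth lam c c' : smooth_vec (solution lam c c').
Proof.
move=> n k t; apply: (smooth_class (pencil_class_derive hQ)) => {n t}.
rewrite (_ : (fun _ => _) = (fun s => \sum_j Q lam s k j * c j 0 +
   \sum_j conjc (Q (conjc lam) s k j) * c' j 0)); last first.
  apply/funext => s; rewrite /solution /Qbar !mxE; congr (_ + _).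
  by apply: eq_bigr => j _; rewrite mxE.
apply: class_add; apply: class_sum => j; apply: class_mul; try exact: class_cst.
  exact: class_pow.
by apply: class_conj; exact: class_pow.
Qed.

(** The equation splits into two first-order equations, so that a solution with zero
    Cauchy data at the angle [0] vanishes. *)
Lemma angular_op_uniq lam (alpha : R) (y y1 y2 : R -> 'cV[R[i]]_l) :
  (forall t, mder y t (y1 t)) -> (forall t, mder y1 t (y2 t)) ->
  (forall t, 0 <= t <= alpha -> angular_op A11 A12 lam (y t) (y1 t) (y2 t) t = 0) ->
  y 0 = 0 -> y1 0 = 0 -> forall t, 0 <= t <= alpha -> y t = 0.
Proof.
move=> d1 d2 hy y0 y10 t ht.
pose w s := residual V lam (y s) (y1 s) s.
have w0 : w 0 = 0 by rewrite /w /residual y0 y10 !mulmx0 scaler0 subrr.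
have hU : pencil_powers U (fun a s => (Qbar a s)^T).
  by rewrite UE; apply: pencil_powers_tr; exact: Qbar_powers.
have wz s : 0 <= s <= alpha -> w s = 0.
  move=> hs; rewrite (first_order_solution hU (a := lam - 1) (y := w)
    (y1 := fun s => residual V lam (y1 s) (y2 s) s -
       (lam *: (mpen V s *m y s) + dmpen V s *m y1 s)) (alpha := alpha))//.
    by rewrite w0 mulmx0.
  move=> x hx; split; first exact: mder_residual.
  by rewrite -(angular_op_factor A11E A12E) hy.
rewrite (first_order_solution hQ (a := lam) (y := y) (y1 := y1) (alpha := alpha))//.
  by rewrite y0 mulmx0.
by move=> x hx; split; [exact: d1|exact: wz].
Qed.

(** Inverting [V - conjmx V] gives constants [c] and [c'] that match the Cauchy data at the
    angle [0]; the difference then vanishes by [angular_op_uniq]. *)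
Lemma solution_space lam (alpha : R) (v v1 v2 : R -> 'cV[R[i]]_l) : lam != 0 ->
  V - conjmx V \in unitmx ->
  (forall t, mder v t (v1 t)) -> (forall t, mder v1 t (v2 t)) ->
  (forall t, 0 <= t <= alpha -> angular_op A11 A12 lam (v t) (v1 t) (v2 t) t = 0) ->
  exists c c', [/\ v 0 = solution lam c c' 0, v1 0 = solution1 lam c c' 0 &
    forall t, 0 <= t <= alpha -> v t = solution lam c c' t].
Proof.
move=> lam0 Vu d1 d2 hv.
pose c := invmx (V - conjmx V) *m (lam^-1 *: v1 0 - conjmx V *m v 0).
pose c' := v 0 - c.
have e0 : v 0 = solution lam c c' 0 by rewrite solution0 /c' addrC subrK.
have e1 : v1 0 = solution1 lam c c' 0.
  rewrite solution10 /c' mulmxBr addrCA -mulmxBl /c mulKVmx// addrC subrK.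
  by rewrite scalerA divff// scale1r.
exists c, c'; split=> // t ht; apply/eqP; rewrite -subr_eq0; apply/eqP.
apply: (@angular_op_uniq lam alpha (fun t => v t - solution lam c c' t)
  (fun t => v1 t - solution1 lam c c' t) (fun t => v2 t - solution2 lam c c' t)) => //.
- by move=> s; apply: mderD => //; apply: mderN; exact: mder_solution.
- by move=> s; apply: mderD => //; apply: mderN; exact: mder_solution1.
- by move=> s hs; rewrite angular_opB hv// solution_angular_op subrr.
- by rewrite e0 subrr.
- by rewrite e1 subrr.
Qed.
End SolutionSpace.

(** * The boundary conditions *)

Section BoundaryConditions.
Variables (R : realType) (n : nat).
Implicit Types (G K Qa Qb : 'M[R[i]]_n) (c s : 'cV[R[i]]_n).

(** With [s = G (c + c')] and [d = G (c - c')], the Neumann condition reads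
    [K s + 'i d = 0] and determines [d] from [s], whether or not [K + 'i] is
    invertible; the Dirichlet condition becomes a linear equation for [s]. *)
Lemma boundary_conditions G K Qa Qb : G \in unitmx ->
  let Za := G *m Qa *m invmx G in let Zb := G *m Qb *m invmx G in
  (exists c c' : 'cV[R[i]]_n, [/\ (c != 0) || (c' != 0),
     G *m K *m G *m (c + c') + 'i *: (G *m G *m (c - c')) = 0 &
     Qa *m c + Qb *m c' = 0]) <->
  (exists2 s : 'cV[R[i]]_n, s != 0 & ('i *: (Za + Zb) - (Za - Zb) *m K) *m s = 0).
Proof.
move=> Gu Za Zb.
have i2 : 'i * 'i = -1 :> R[i] by rewrite -expr2 sqr_i.
have two0 : (2 : R[i]) != 0 by rewrite pnatr_eq0.
have i0 : 'i != 0 :> R[i] by rewrite eq_complex /= oner_eq0 andbF.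
have ME s : ('i *: (Za + Zb) - (Za - Zb) *m K) *m s =
    'i *: (Za *m (s + 'i *: (K *m s)) + Zb *m (s - 'i *: (K *m s))).
  rewrite mulmxBl -scalemxAl -mulmxA mulmxDl mulmxBl !mulmxDr mulmxN -!scalemxAr.
  move: (Za *m s) (Zb *m s) (Za *m (K *m s)) (Zb *m (K *m s)) => a b a' b'.
  rewrite !scalerDr scalerN !scalerA i2 !scaleN1r opprB opprK.
  by rewrite [b' - a']addrC addrACA.
have ZG c c' : Za *m (G *m c) + Zb *m (G *m c') = G *m (Qa *m c + Qb *m c').
  by rewrite /Za /Zb !mulmxA !mulmxKV// mulmxDr !mulmxA.
split.
  move=> [c [c' [cc N Dir]]].
  have N' : G *m (c - c') = 'i *: (K *m (G *m (c + c'))).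
    have h : K *m (G *m (c + c')) + 'i *: (G *m (c - c')) = 0.
      by rewrite -[LHS](mulKmx Gu) mulmxDr -scalemxAr !mulmxA N mulmx0.
    have := congr1 (fun x => 'i *: x) h; rewrite scaler0 scalerDr scalerA i2 scaleN1r.
    by move/eqP; rewrite subr_eq0 => /eqP ->.
  have cE : G *m (c + c') + 'i *: (K *m (G *m (c + c'))) = G *m (2 *: c).
    by rewrite -N' -mulmxDr; congr (_ *m _); apply/colP => k; rewrite !mxE; ring.
  have cE' : G *m (c + c') - 'i *: (K *m (G *m (c + c'))) = G *m (2 *: c').
    by rewrite -N' -mulmxBr; congr (_ *m _); apply/colP => k; rewrite !mxE; ring.
  exists (G *m (c + c')).
    apply: contraNneq (negbT erefl : ~~ false) => s0.
    rewrite s0 mulmx0 scaler0 add0r in cE; rewrite s0 mulmx0 scaler0 subr0 in cE'.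
    have z (x : 'cV[R[i]]_n) : 0 = G *m (2 *: x) -> x = 0.
      by move=> /(congr1 (mulmx (invmx G))); rewrite mulmx0 mulKmx// => /esym/eqP;
         rewrite scaler_eq0 (negbTE two0) => /eqP.
    by rewrite (z _ cE) (z _ cE') eqxx in cc.
  by rewrite ME cE cE' ZG -!scalemxAr -scalerDr Dir scaler0 mulmx0 scaler0.
move=> [s s0 Ms]; pose d := 'i *: (K *m s).
exists (invmx G *m (2^-1 *: (s + d))), (invmx G *m (2^-1 *: (s - d))).
have half : (2^-1 + 2^-1 : R[i]) = 1 by rewrite -mulr2n -[_ *+ 2]mulr_natr mulVf.
have sum2 : 2^-1 *: (s + d) + 2^-1 *: (s - d) = s.
  by rewrite -scalerDr addrACA subrr addr0 scalerDr -scalerDl half scale1r.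
have dif2 : 2^-1 *: (s + d) - 2^-1 *: (s - d) = d.
  by rewrite -scalerBr opprB addrC addrA subrK scalerDr -scalerDl half scale1r.
split.
- rewrite -negb_and; apply: contra s0 => /andP[/eqP h1 /eqP h2].
  by rewrite -sum2 -[_ *: (s + d)](mulKVmx Gu) -[_ *: (s - d)](mulKVmx Gu) h1 h2 !mulmx0 addr0.
- rewrite -mulmxDr -mulmxBr sum2 dif2 -!mulmxA !mulKVmx// /d -!scalemxAr scalerA i2 scaleN1r.
  by rewrite subrr.
have {}Ms : Za *m (s + d) + Zb *m (s - d) = 0.
  by move/eqP: Ms; rewrite ME scaler_eq0 (negbTE i0) => /eqP.
rewrite -[LHS](mulKmx Gu) -ZG !mulKVmx// -!scalemxAr -scalerDr Ms scaler0.
by rewrite mulmx0.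
Qed.
End BoundaryConditions.

Section ModelProblem.
Variables (R : realType) (n : nat).
Implicit Types (D S : 'M[R]_n).

Lemma toCM p q r (X : 'M[R]_(p, q)) (Y : 'M[R]_(q, r)) : toC (X *m Y) = toC X *m toC Y.
Proof. exact: map_mxM. Qed.
Lemma toCB p q (X Y : 'M[R]_(p, q)) : toC (X - Y) = toC X - toC Y.
Proof. exact: map_mxB. Qed.
Lemma toC_unit (X : 'M[R]_n) : (toC X \in unitmx) = (X \in unitmx).
Proof. exact: map_unitmx. Qed.
Lemma toC_inv (X : 'M[R]_n) : toC (invmx X) = invmx (toC X).
Proof. exact: map_invmx. Qed.
Lemma toC_tr p q (X : 'M[R]_(p, q)) : toC X^T = (toC X)^T.
Proof. by apply/matrixP => i j; rewrite !mxE. Qed.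

Lemma posdef_unit D : posdefmx D -> D \in unitmx.
Proof.
move=> [DT Dpos]; rewrite unitmxE unitfE; apply/det0P => -[v v0 vD].
by have := Dpos v^T; rewrite trmx_eq0 trmxK vD mul0mx mxE ltxx => /(_ v0).
Qed.

(** Comparison of the coefficients of the symbol, from its values at [0] and [1]. *)
Lemma symbol_factor (A11 A12 : 'M[R]_n) (V : 'M[R[i]]_n) : standard_root A11 A12 V ->
  toC A11 = (conjmx V)^T *m V /\ toC A12 = - (2^-1 *: ((conjmx V)^T + V)).
Proof.
move=> [_ h]; have two0 : (2 : R[i]) != 0 by rewrite pnatr_eq0.
have h0 : toC A11 = (conjmx V)^T *m V.
  have := h 0; rewrite /symbol2 expr1n scale1r mulr0 scale0r addr0 expr0n /=.
  have -> : 0%:M = 0 :> 'M[R[i]]_n by apply/matrixP => i j; rewrite !mxE mul0rn.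
  by rewrite addr0 !subr0.
split=> //; have := h 1; rewrite /symbol2 !expr1n scale1r !mulr1 h0.
rewrite mulmxBr !mulmxBl mulmx1 !mul1mx => h1.
apply: (scalerI two0); rewrite scalerN scalerA divff// scale1r.
move: h1; move: ((conjmx V)^T *m V) => X h1.
have -> : 2 *: toC A12 = X + 2 *: toC A12 + 1%:M - X - 1%:M by apply/matrixP => i j; rewrite !mxE; ring.
by rewrite h1; apply/matrixP => i j; rewrite !mxE; ring.
Qed.

Lemma similar_pencil (G V : 'M[R[i]]_n) (c s : R[i]) : G \in unitmx ->
  G *m (c%:M + s *: V) *m invmx G = c%:M + s *: (G *m V *m invmx G).
Proof.
move=> Gu; rewrite mulmxDr mulmxDl mul_mx_scalar -!scalemxAl mulmxV// scalemx1.
by rewrite -scalemxAr -scalemxAl.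
Qed.

Lemma similar_commutator (G X : 'M[R[i]]_n) : G \in unitmx ->
  let Y := invmx G *m X *m invmx G in
  G *m (Y *m (G *m G) - G *m G *m Y) *m G = X *m (G *m G) - G *m G *m X.
Proof.
move=> Gu Y; rewrite /Y mulmxBr mulmxBl !mulmxA.
by rewrite mulmxV// mul1mx !mulmxKV// mulmxK.
Qed.

Lemma neumann_halves (s d : 'M[R[i]]_n) (c c' : 'cV[R[i]]_n) :
  - (2^-1 *: (d *m (s - 'i%:M) + (s + 'i%:M) *m d)) *m (c + c') +
    ((s + 'i%:M) *m d *m c + (s - 'i%:M) *m d *m c') =
  2^-1 *: (s *m d - d *m s) *m (c + c') + 'i *: (d *m (c - c')).
Proof.
rewrite mulmxBr mulmxBl mulmxDl mul_mx_scalar !mul_scalar_mx.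
move: (s *m d) (d *m s) => P T.
rewrite mulNmx -!scalemxAl !mulmxDl !mulNmx -!scalemxAl !mulmxDr !mulmxN.
move: (P *m c) (P *m c') (T *m c) (T *m c') (d *m c) (d *m c') => pc pc' tc tc' dc dc'.
by apply/colP => k; rewrite !mxE; field.
Qed.

Variables (S D Dh : 'M[R]_n) (V : 'M[R[i]]_n).
Hypothesis hSD : root_decomposition V S D.
Hypothesis hDh : posdef_sqrt D Dh.
Let G := toC Dh.

Lemma sqrt_unit : G \in unitmx.
Proof. by rewrite toC_unit; case: hDh => /posdef_unit. Qed.

Lemma toC_D : toC D = G *m G.
Proof. by case: hDh => _ <-; rewrite toCM. Qed.

Lemma root_conj : conjmx V = (toC S - 'i%:M) *m toC D.
Proof.
case: hSD => _ _ ->; rewrite conjmatM conjmatD conjmat_scalar !conjmat_toC.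
by congr ((_ + _) *m _); rewrite -raddfN /=; congr (_%:M); apply: complex_ext; rewrite /= ?oppr0.
Qed.

Lemma root_adj : (conjmx V)^T = toC D *m (toC S - 'i%:M).
Proof.
case: hSD => ST [DT _] _.
by rewrite root_conj trmx_mul linearB /= tr_scalar_mx -!toC_tr ST DT.
Qed.

Lemma root_sub_conj_unit : V - conjmx V \in unitmx.
Proof.
have -> : V - conjmx V = (2 * 'i) *: toC D.
  rewrite root_conj; case: hSD => _ _ ->; rewrite -mulmxBl opprB addrC addrA subrK.
  by rewrite -raddfD /= mul_scalar_mx; congr (_ *: _); ring.
rewrite unitmxZ ?toC_unit; first by case: hSD => _ /posdef_unit.
by rewrite unitfE mulf_neq0 ?pnatr_eq0// eq_complex /= oner_eq0 andbF.
Qed.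

Lemma Zmx_similar alpha : Zmx S D Dh alpha = G *m mpen V alpha *m invmx G.
Proof.
have Gu := sqrt_unit.
have VE : G *m V *m invmx G = toC (Dh *m S *m Dh) + 'i *: toC D.
  case: hSD => _ _ ->; rewrite !toCM -/G toC_D !mulmxA mulmxK//.
  by rewrite mulmxDr mulmxDl mul_mx_scalar -scalemxAl.
rewrite /Zmx /mpen (similar_pencil _ _ _ Gu) VE scalerDr scalerA addrA.
by congr (_ + _ *: _); rewrite mulrC.
Qed.

Let K := 2^-1 *: toC (mxcomm (invmx Dh *m S *m invmx Dh) D).

(** [K] is half the commutator of the theorem.  The congruence by the square root turns it
    into half the commutator of [S] and [D], which equals [A12 + V - i D]. *)
Lemma commutator_form :
  G *m K *m G = 2^-1 *: (toC S *m toC D - toC D *m toC S).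
Proof.
rewrite /K -scalemxAr -scalemxAl; congr (_ *: _).
by rewrite /mxcomm toCB !toCM toC_inv -/G toC_D (similar_commutator _ sqrt_unit).
Qed.

Lemma commutator_tr : K^T = - K.
Proof.
have [ST [DT _] _] := hSD; have [[DhT _] _] := hDh.
have XT : (invmx Dh *m S *m invmx Dh)^T = invmx Dh *m S *m invmx Dh.
  by rewrite !trmx_mul !trmx_inv DhT ST mulmxA.
move: XT; rewrite /K; set X := _ *m S *m _ => XT; clearbody X.
by rewrite linearZ /= -toC_tr /mxcomm linearB /= !trmx_mul XT DT -scalerN !toCB opprB.
Qed.

(** The conormal derivative of the solution on the side [t = 0], up to the factor [lam]. *)
Lemma neumann_form (A11 A12 : 'M[R]_n) (c c' : 'cV[R[i]]_n) : standard_root A11 A12 V ->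
  toC A12 *m (c + c') + (V *m c + conjmx V *m c') =
  G *m K *m G *m (c + c') + 'i *: (G *m G *m (c - c')).
Proof.
move=> /symbol_factor[_ ->]; rewrite commutator_form -toC_D root_adj root_conj.
by case: hSD => _ _ ->; exact: neumann_halves.
Qed.

Lemma Zmx_tr alpha : (Zmx S D Dh alpha)^T = Zmx S D Dh alpha.
Proof.
have [ST [DT _] _] := hSD; have [[DhT _] _] := hDh.
by rewrite /Zmx !linearD !linearZ /= tr_scalar_mx -!toC_tr !trmx_mul ST DT DhT mulmxA.
Qed.

(** Transposition moves the skew matrix [K] to the right, where it acts on [s]. *)
Lemma Mmx_tr lam alpha (Z := Zmx S D Dh alpha) :
  (Mmx S D Dh lam alpha)^T = 'i *: (hfc (cpowp lam) Z + hfc (cpowm lam) (conjmx Z))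
    - (hfc (cpowp lam) Z - hfc (cpowm lam) (conjmx Z)) *m K.
Proof.
have Zt : Z^T = Z by exact: Zmx_tr.
have Zbt : (conjmx Z)^T = conjmx Z by rewrite -[in RHS]Zt; apply/matrixP => i j; rewrite !mxE.
rewrite /Mmx -/Z scalemxAl -/K; move: commutator_tr.
move: (trmx_hfc (cpowp lam) Zt) (trmx_hfc (cpowm lam) Zbt).
move: (hfc _ Z) (hfc _ (conjmx Z)) K => Zp Zm k hp hm hk.
by rewrite linearD /= linearZ /= trmx_mul hk linearB linearD /= hp hm mulmxN addrC.
Qed.
End ModelProblem.

Theorem proposition5p2 (R : realType) (l : nat) (alpha : R)
    (halpha : 0 < alpha < 2 * pi)
    (A11 A12 : 'M[R]_l) (hA : monic_elliptic A11 A12)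
    (V : 'M[R[i]]_l) (hV : standard_root A11 A12 V)
    (S D : 'M[R]_l) (hSD : root_decomposition V S D)
    (Dh : 'M[R]_l) (hDh : posdef_sqrt D Dh)
    (lam : R[i]) (hlam : lam != 0) :
  (exists v : R -> 'cV[R[i]]_l, mixed_solution A11 A12 alpha lam v) <->
  eigenvalue (Mmx S D Dh lam alpha) 0.
Proof.
case: l => [|n] in A11 A12 hA V hV S D hSD Dh hDh *.
  split=> [[v [_ _ _ _ [r [phi [_ _]]]]]|/eigenvalueP[v _ /negP[]]].
    by rewrite flatmx0 eqxx.
  by rewrite thinmx0.
have [Q hQ hfcQ] := pencil_powers_exist (proj1 hV).
have [A11E A12E] := symbol_factor hV.
have Gu := sqrt_unit hDh.
have [hp hm] := hfcQ (toC Dh) alpha lam Gu halpha.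
rewrite -(Zmx_similar hSD hDh) in hp hm.
have a0 : 0 <= alpha by case/andP: halpha => /ltW.
have rpow1 (mu : R[i]) : rpow mu 1 = 1.
  by rewrite /rpow ln1 mulr0 cexp0.
pose K := 2^-1 *: toC (mxcomm (invmx Dh *m S *m invmx Dh) D).
have key := boundary_conditions K (Q lam alpha) (Qbar Q lam alpha) Gu.
have hm' : hfc (cpowm lam) (conjmx (Zmx S D Dh alpha)) =
    toC Dh *m Qbar Q lam alpha *m invmx (toC Dh).
  by rewrite hm !conjmatM -toC_inv !conjmat_toC.
rewrite /= -hp -hm' -(Mmx_tr hSD hDh) in key.
(* [eigenvalue] speaks of left null vectors *)
have evE : eigenvalue (Mmx S D Dh lam alpha) 0 <->
    exists2 s : 'cV[R[i]]_n.+1, s != 0 & (Mmx S D Dh lam alpha)^T *m s = 0.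
  split=> [/eigenvalueP[v]|[s s0 Ms]].
    rewrite scale0r => vM v0; exists v^T; first by rewrite trmx_eq0.
    by rewrite -trmx_mul vM trmx0.
  apply/eigenvalueP; exists s^T; last by rewrite trmx_eq0.
  by rewrite scale0r -[Mmx _ _ _ _ _]trmxK -trmx_mul Ms trmx0.
apply: iff_trans (iff_sym evE); apply: iff_trans key; split.
  move=> [v [sv ell con dir [r [phi [_ phia vphi]]]]].
  have [d1 d2] := smooth_vec_mder sv.
  have hop t : 0 <= t <= alpha ->
      angular_op A11 A12 lam (v t) (vderive v t) (vderive (vderive v) t) t = 0.
    move=> ht; have := ell 1 t ltr01 ht.
    by rewrite (elliptic_op_power A11 A12 lam t d1 d2 ltr01) rpow1 scale1r.
  have [c [c' [e0 e1 ev]]] := solution_space erefl A11E A12E hQ hlam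
    (root_sub_conj_unit hSD) d1 d2 hop.
  exists c, c'; split.
  - rewrite -negb_and; apply: contra vphi => /andP[/eqP c0 /eqP c0'].
    by rewrite /power_fun ev// /solution c0 c0' !mulmx0 addr0 scaler0.
  - rewrite -(neumann_form hSD hDh c c' hV).
    have := con 1 ltr01; rewrite (conormal_power A11 A12 lam d1 ltr01) rpow1 scale1r.
    rewrite e0 e1 (solution0 hQ) (solution10 hQ) -scalerDr => /eqP.
    by rewrite scaler_eq0 (negbTE hlam) => /eqP.
  - have := dir 1 ltr01; rewrite /power_fun rpow1 scale1r ev//.
    by rewrite a0 lexx.
move=> [c [c' [cc N Dir]]].
pose v := solution Q lam c c'.
have d1 := mder_solution hQ lam c c'; have d2 := mder_solution1 hQ lam c c'.
exists v; split.
- exact: (solution_smooth hQ).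
- move=> r phi r0 _; rewrite (elliptic_op_power A11 A12 lam phi d1 d2 r0).
  by rewrite (solution_angular_op erefl A11E A12E hQ) scaler0.
- move=> r r0; rewrite (conormal_power A11 A12 lam d1 r0) (solution0 hQ) (solution10 hQ).
  by rewrite -scalerDr (neumann_form hSD hDh c c' hV) N !scaler0.
- by move=> r _; rewrite /power_fun /v /solution Dir scaler0.
exists 1, 0; split=> //; first by rewrite lexx.
rewrite /power_fun rpow1 scale1r /v (solution0 hQ).
(* By the Neumann condition, [c + c' = 0] would force [c - c' = 0] as well. *)
apply: contraTneq cc => cc0; move: N; rewrite cc0 mulmx0 add0r => /eqP.
rewrite scaler_eq0 eq_complex /= oner_eq0 andbF /= => /eqP h.
have d0 : c - c' = 0.
  by rewrite -[LHS](mulKmx Gu) -[toC Dh *m (c - c')](mulKmx Gu) [toC Dh *m (_ *m _)]mulmxA h !mulmx0.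
have c0 : c = 0.
  have : 2 *: c = (c + c') + (c - c') by apply/colP => k; rewrite !mxE; ring.
  by rewrite cc0 d0 addr0 => /eqP; rewrite scaler_eq0 pnatr_eq0 => /eqP.
by rewrite negb_or !negbK c0 eqxx; move: d0; rewrite c0 sub0r => /eqP; rewrite oppr_eq0.
Qed.
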